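(* Let $G=(V,E)$ be a Gaussian tree, let $a,c,c'\in V$ with $a\neq c$, and let $Z\subseteq V\setminus\{a,c\}$ and $Z'\subseteq V\setminus\{a,c'\}$. Assume that $c$ lies on the unique path in $G$ joining $a$ and $c'$ (endpoints included) and that $\{a,c'\}$ is separated from $Z$ given $Z'$ in $G$. Then $$\rho^2_{ac'\mid Z'}\le\rho^2_{ac\mid Z}.$$
   Context: In an undirected graph, $A,C\subseteq V$ are separated given $S\subseteq V\setminus(A\cup C)$ if every path from a vertex of $A$ to a vertex of $C$ intersects $S$. A Gaussian tree is a finite undirected tree $G=(V,E)$ together with a Gaussian random vector indexed by $V$ (also denoted $V$), $V\sim N(\mu,\Sigma)$ with $\Sigma$ positive definite, such that for pairwise disjoint $T_1,T_2,T_3\subseteq V$, $T_1$ and $T_2$ are conditionally independent given $T_3$ whenever $T_1$ and $T_2$ are separated given $T_3$ in $G$. (The converse is not assumed.) For distinct $u,v$ and $Z\subseteq V\setminus\{u,v\}$ the squared partial correlation is $$\rho^2_{uv\mid Z}=\frac{(\sigma_{uv}-\Sigma_{uZ}\Sigma_{ZZ}^{-1}\Sigma_{Zv})^2}{(\sigma_{uu}-\Sigma_{uZ}\Sigma_{ZZ}^{-1}\Sigma_{Zu})(\sigma_{vv}-\Sigma_{vZ}\Sigma_{ZZ}^{-1}\Sigma_{Zv})},$$ where $\sigma_{uv}$ is the $(u,v)$ entry of $\Sigma$ and $\Sigma_{uZ}$ etc. are submatrices; for $Z=\emptyset$ the correction terms are absent. *)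

(* Defs.v *)
From HB Require Import structures.
From mathcomp Require Import all_boot all_order all_algebra.
From mathcomp Require Import all_classical all_reals all_analysis.

Set Implicit Arguments.
Unset Strict Implicit.
Unset Printing Implicit Defensive.

Import Order.TTheory GRing.Theory Num.Theory.

Local Open Scope classical_set_scope.
Local Open Scope ring_scope.

Section Graphs.
Variables (V : finType) (e : rel V).

(* The vertices of the path are x :: p; the path of length 0 is allowed. *)
Definition joins (x y : V) (p : seq V) : Prop :=
  [/\ path e x p, uniq (x :: p) & last x p = y].

(* [ucycle] counts an edge (traversed back and forth) as a cycle of size 2. *)
Definition is_tree : Prop :=
  [/\ symmetric e, irreflexive e,
      forall x y, exists p, joins x y p &
      forall s, ucycle e s -> (size s <= 2)%N].

(* A and C are separated given S; the side condition on S is part of the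
   notion. *)
Definition graph_separated (A C S : {set V}) : Prop :=
  S \subset ~: (A :|: C) /\
  forall x y p, x \in A -> y \in C -> joins x y p ->
    exists2 z, z \in x :: p & z \in S.

(* z lies on a path (in a tree: the path) joining x and y. *)
Definition on_path (x y z : V) : Prop :=
  exists2 p, joins x y p & z \in x :: p.

End Graphs.

Section Covariance.
Variables (R : realType) (V : finType).

Definition posdef (sigma : V -> V -> R) : Prop :=
  (forall u v, sigma u v = sigma v u) /\
  forall t : V -> R, (exists v, t v != 0) ->
    0 < \sum_u \sum_v t u * sigma u v * t v.

Variable sigma : V -> V -> R.

(* The submatrices of sigma, with rows and columns listed along [enum Z]. *)
Definition sub_row (u : V) (Z : {set V}) : 'rV[R]_#|Z| :=
  \row_j sigma u (enum_val j).
Definition sub_col (Z : {set V}) (v : V) : 'cV[R]_#|Z| :=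
  \col_i sigma (enum_val i) v.
Definition sub_mx (Z : {set V}) : 'M[R]_#|Z| :=
  \matrix_(i, j) sigma (enum_val i) (enum_val j).

Definition pcov (u v : V) (Z : {set V}) : R :=
  sigma u v - (sub_row u Z *m invmx (sub_mx Z) *m sub_col Z v) ord0 ord0.

Definition sq_pcorr (u v : V) (Z : {set V}) : R :=
  pcov u v Z ^+ 2 / (pcov u u Z * pcov v v Z).

End Covariance.

Section Probability.
Context {d : measure_display} {Omega : measurableType d} {R : realType}.
Variable P : probability Omega R.

(* f is a version of the conditional probability P(A | G). *)
Definition cond_prob_version (G : set (set Omega)) (A : set Omega)
    (f : Omega -> R) : Prop :=
  [/\ forall B : set R, measurable B -> G (f @^-1` B),
      P.-integrable [set: Omega] (EFin \o f) &
      forall C, G C -> (\int[P]_(w in C) (f w)%:E = P (A `&` C))%E].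

Variables (V : finType) (X : V -> {RV P >-> R}).

Definition sigma_of (T : {set V}) : set (set Omega) :=
  <<s \bigcup_(v in [set` T]) preimage_set_system setT (X v) measurable >>.

(* P(A `&` B | X_T3) = P(A | X_T3) P(B | X_T3) almost surely, for A in
   sigma(X_T1) and B in sigma(X_T2).  Versions of a conditional probability
   exist and are almost surely equal, so the choice of f and g is
   immaterial. *)
Definition cond_indep (T1 T2 T3 : {set V}) : Prop :=
  forall A B, sigma_of T1 A -> sigma_of T2 B ->
    exists f g : Omega -> R,
      [/\ cond_prob_version (sigma_of T3) A f,
          cond_prob_version (sigma_of T3) B g &
          cond_prob_version (sigma_of T3) (A `&` B) (f \* g)].

(* X ~ N(mu, sigma) for a positive definite sigma: each nontrivial linear
   combination of the coordinates is univariate normal, with the mean and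
   variance that mu and sigma prescribe.  The second parameter of
   [normal_prob] is the standard deviation. *)
Definition gaussian_vector (mu : V -> R) (sigma : V -> V -> R) : Prop :=
  forall t : V -> R, (exists v, t v != 0) ->
  forall B : set R, measurable B ->
    P ((fun w => \sum_v t v * X v w) @^-1` B) =
    normal_prob (\sum_v t v * mu v)
      (Num.sqrt (\sum_u \sum_v t u * sigma u v * t v)) B.

Definition gaussian_tree (e : rel V) (mu : V -> R) (sigma : V -> V -> R) :
    Prop :=
  [/\ is_tree e, posdef sigma, gaussian_vector mu sigma &
      forall T1 T2 T3 : {set V},
        [disjoint T1 & T2]%B -> [disjoint T1 & T3]%B -> [disjoint T2 & T3]%B ->
        graph_separated e T1 T2 T3 -> cond_indep T1 T2 T3].

End Probability.

(* Main.v *)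
(**
Conditional independence of X_u and X_v given X_w only has to be exploited for
single vertices u, v, w.  Let U be the residual of X_u after linear regression
on X_w.  As U and X_w are uncorrelated, W + sU and W - sU (W the centered X_w)
have the same law; hence s |-> E (W + sU - c)^+ is even, and its derivative at 0
gives E (U 1_{W > c}) = 0 for all c.  So E (U h(X_w)) = 0 for all bounded h, and
conditional independence then yields E (U 1_B) = 0 for B in sigma(X_v), whence
cov (U, X_v) = 0, that is, sigma_uv sigma_ww = sigma_uw sigma_wv.

Call a covariance Markov when s_uv = s_uw s_wv / s_ww whenever w separates u
from v.  Conditioning on one more vertex z (a rank-one Schur complement)
preserves this property, because w separates z from u or from v.  Partial
covariances given Z are obtained by conditioning on the vertices of Z one after
the other, in any order.  Adding Z to Z' does not change rho^2_{ac'}, since the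
residuals of a and c' given Z' are uncorrelated with those of Z; removing Z'
afterwards cannot decrease it (compare a, c', z through their median vertex in
the tree); finally rho_{ac'|Z} = rho_{ac|Z} rho_{cc'|Z} as c separates a from c'.
*)

Require Import Defs.
From HB Require Import structures.
From mathcomp Require Import all_boot all_order all_algebra.
From mathcomp Require Import all_classical all_reals all_analysis.
From mathcomp Require Import measurable_realfun ring lra.

Set Implicit Arguments.
Unset Strict Implicit.
Unset Printing Implicit Defensive.

Import Order.TTheory GRing.Theory Num.Theory.
Import numFieldNormedType.Exports.

Local Open Scope classical_set_scope.
Local Open Scope ring_scope.

(** * Separation in trees *)

Section Separation.
Variables (V : finType) (e : rel V).

Definition avoid (w : V) : rel V := [rel x y | [&& e x y, x != w & y != w]].

(** Separation by one vertex, phrased as connectivity after deletion of [w]. Unlike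
    [graph_separated] it lets [w] be an endpoint, so the algebra on covariances needs no case
    distinction. *)
Definition cuts (w u v : V) : bool :=
  [|| u == w, v == w | ~~ connect (avoid w) u v].

Lemma path_avoid w x p :
  path e x p -> w \notin x :: p -> path (avoid w) x p.
Proof.
elim: p x => // y p IH x /andP[exy py].
rewrite !inE !negb_or => /and3P[wx wy wp].
by rewrite /= IH ?inE ?negb_or ?wy // andbT /avoid /= exy eq_sym wx eq_sym wy.
Qed.

Lemma avoid_path w x p : path (avoid w) x p -> path e x p.
Proof. by apply: sub_path => a b /and3P[]. Qed.

Lemma avoid_notin w x p : x != w -> path (avoid w) x p -> w \notin x :: p.
Proof.
elim: p x => [|y p IH] x xw /=; first by rewrite inE eq_sym.
by case/andP=> /and3P[_ _ yw] /(IH _ yw); rewrite (in_cons x) negb_or (eq_sym w) xw.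
Qed.

Lemma cuts_joins w u v p : cuts w u v -> joins e u v p -> w \in u :: p.
Proof.
move=> cw [pp _ lp]; apply/negPn/negP => wp; case/or3P: cw => [/eqP uw|/eqP vw|].
- by rewrite uw mem_head in wp.
- by rewrite -vw -lp mem_last in wp.
- by apply/negP; rewrite negbK; apply/connectP; exists p => //; exact: path_avoid.
Qed.

Lemma cuts_graph_separated w u v :
  w != u -> w != v -> cuts w u v -> graph_separated e [set u] [set v] [set w].
Proof.
move=> wu wv cw; split; first by rewrite finset.sub1set !inE negb_or wu wv.
move=> x y p; rewrite !inE => /eqP-> /eqP-> /(cuts_joins cw) wp.
by exists w; rewrite ?inE.
Qed.

Hypothesis e_sym : symmetric e.

Lemma avoid_sym w : connect_sym (avoid w).
Proof.
by apply: sym_connect_sym => x y; rewrite /avoid /= e_sym; congr andb; rewrite andbC.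
Qed.

Lemma cuts_sym w u v : cuts w u v = cuts w v u.
Proof. by rewrite /cuts avoid_sym orbCA. Qed.

(** If [z] were linked to both [u] and [v] off [w], then [u] and [v] would be linked through [z]. *)
Lemma cuts_split w u v z : cuts w u v -> cuts w z u || cuts w z v.
Proof.
rewrite /cuts; case: (eqVneq z w) => //= zw.
case: (eqVneq u w) => //= uw; case: (eqVneq v w) => [|_] //=; first by rewrite orbT.
rewrite -negb_and => nc; apply: contra nc => /andP[zu zv].
by apply: connect_trans zv; rewrite avoid_sym.
Qed.

Hypothesis e_irr : irreflexive e.
Hypothesis e_conn : forall x y, exists p, joins e x y p.
Hypothesis e_acyclic : forall s, ucycle e s -> (size s <= 2)%N.

(** A simple path from [u] to [v] off [w] would close up through [w] to a cycle with at least three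
    vertices. *)
Lemma tree_neighbours_cut w u v : e w u -> e w v -> u != v -> cuts w u v.
Proof.
move=> wu wv uv; have neq x : e w x -> x != w.
  by move=> wx; apply: contraTneq wx => ->; rewrite e_irr.
rewrite /cuts (negbTE (neq _ wu)) (negbTE (neq _ wv)) /=.
apply/negP => /connectP[p pp vE]; move: uv wv; rewrite vE => {vE}.
case/shortenP: pp => q pq uq _ uv wv.
have wq := avoid_notin (neq _ wu) pq.
have := @e_acyclic (w :: u :: q); rewrite /ucycle /= wu wq.
rewrite rcons_path (avoid_path pq) e_sym wv /=.
case: q pq uq uv {wv wq} => [|z q] _; first by rewrite eqxx.
by move=> /= -> _ /(_ isT).
Qed.

(** After deletion of [w], the two halves of the path still link [u] and [v] to the neighbours of
    [w] on the path, and these two neighbours are no longer connected. *)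
Lemma tree_on_path_cuts u v w : on_path e u v w -> cuts w u v.
Proof.
case=> p [pp up lp] wp; rewrite /cuts.
case: eqVneq => //= uw; case: eqVneq => //= vw.
have {}wp : w \in p by rewrite inE eq_sym (negbTE uw) in wp.
case/splitPr: wp pp up lp => p1 p2.
rewrite -cat_cons cat_uniq last_cat cat_path.
move=> /andP[pp1 pw] /and3P[_ /hasPn h1 uw2] lp.
case: p2 pw h1 uw2 lp => [|y p2].
  by move=> _ _ _ /esym /eqP; rewrite (negbTE vw).
case/and3P=> ew ewy py h1 /andP[wp2 _] lp.
have wp1 : w \notin u :: p1 by apply: h1; rewrite mem_head.
have ly : last u p1 != y.
  apply/eqP => ly; have /h1/negP : y \in [:: w, y & p2] by rewrite !inE eqxx orbT.
  by apply; rewrite -ly; exact: mem_last.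
rewrite e_sym in ew.
have := tree_neighbours_cut ew ewy ly; rewrite /cuts.
have -> : (last u p1 == w) = false by apply: contraNF wp1 => /eqP<-; rewrite mem_last.
have -> : (y == w) = false by apply: contraNF wp2 => /eqP->; rewrite mem_head.
move=> /= nc; apply: contra nc => cuv.
apply: (@connect_trans _ _ u).
  by rewrite avoid_sym; apply/connectP; exists p1 => //; exact: path_avoid.
apply: connect_trans cuv _; rewrite avoid_sym.
by apply/connectP; exists p2 => //; exact: path_avoid.
Qed.

(** The median is the vertex where the path from [z] to [u] first meets the path from [u] to [v]. *)
Lemma tree_median u v z : exists p, [/\ cuts p u v, cuts p z u & cuts p z v].
Proof.
have [q [pq uq lq]] := e_conn u v; have [r [pr ur lr]] := e_conn z u.
have hr : has (mem (u :: q)) (z :: r).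
  by apply/hasP; exists u; rewrite /= ?mem_head // -lr mem_last.
have [r1 [p [r2 [rE r1q pIq]]]] : exists r1 p r2,
    [/\ z :: r = r1 ++ p :: r2, ~~ has (mem (u :: q)) r1 & p \in u :: q].
  by case/split_find: hr => p r1 r2 pu nr; exists r1, p, r2; rewrite cat_rcons.
exists p; split.
- by apply: tree_on_path_cuts; exists q.
- by apply: tree_on_path_cuts; exists r => //; rewrite rE mem_cat mem_head orbT.
apply: tree_on_path_cuts.
have [q1 [q2 qE]] : exists q1 q2, u :: q = q1 ++ p :: q2.
  by case/splitPr: pIq => q1 q2; exists q1, q2.
have sq : sorted e (u :: q) by [].
have sr : sorted e (z :: r) by [].
have pq2 : path e p q2 by move: sq; rewrite qE sorted_cat_cons => /andP[].
have srr : sorted e (rcons r1 p).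
  by move: sr; rewrite rE -cat_rcons => /cat_sorted2[].
have uq2 : uniq (p :: q2) by move: uq; rewrite qE cat_uniq => /and3P[].
have lq2 : last p q2 = v by rewrite -lq -[last u q]/(last u (u :: q)) qE last_cat.
(* Leaving the first path at [p] and following the second one to [v] repeats no vertex, since [r1]
   stops before it touches the path from [u] to [v]. *)
have ur1 : uniq (r1 ++ p :: q2).
  rewrite cat_uniq uq2 andbT; apply/andP; split.
    by move: ur; rewrite rE cat_uniq => /and3P[].
  rewrite has_sym; apply: contra r1q => /hasP[x xr xp]; apply/hasP; exists x => //=.
  by rewrite qE mem_cat xp orbT.
have hz : z :: behead (r1 ++ p :: q2) = r1 ++ p :: q2.
  by move: rE; case: (r1) => /= [[->]|x s [->]].
have lv : last z (behead (r1 ++ p :: q2)) = v.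
  by rewrite -[last z _]/(last z (z :: _)) hz last_cat.
exists (behead (r1 ++ p :: q2)); last by rewrite hz mem_cat mem_head orbT.
split; [|by rewrite hz|by []].
have : sorted e (r1 ++ p :: q2).
  rewrite sorted_cat_cons pq2 andbT; move: srr; case: (r1) => //= x s.
by rewrite -hz.
Qed.

End Separation.

(** * Partial covariances by successive conditioning *)

Section Forms.
Variables (R : realFieldType) (V : finType).
Implicit Types (s : V -> V -> R) (t : V -> R).

Definition form s t : R := \sum_u \sum_v t u * s u v * t v.

Definition psd s : Prop :=
  (forall u v, s u v = s v u) /\ forall t, 0 <= form s t.

Lemma sum_delta (F : V -> R) (z : V) : \sum_v F v * (v == z)%:R = F z.
Proof.
rewrite (bigD1 z) //= eqxx mulr1 big1 ?addr0 // => v /negbTE ->.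
by rewrite mulr0.
Qed.

Lemma sum_deltal (F : V -> R) (z : V) : \sum_v (v == z)%:R * F v = F z.
Proof. by rewrite -[RHS]sum_delta; apply: eq_bigr => v _; rewrite mulrC. Qed.

Lemma form_delta s z : form s (fun u => (u == z)%:R) = s z z.
Proof.
rewrite /form -[RHS](sum_deltal (s^~ z)); apply: eq_bigr => u _.
by rewrite sum_delta.
Qed.

Lemma form_bump s t x z : (forall u v, s u v = s v u) ->
  form s (fun u => t u + x * (u == z)%:R) =
  form s t + 2 * x * (\sum_u t u * s u z) + x ^+ 2 * s z z.
Proof.
move=> s_sym; rewrite /form.
transitivity (\sum_u (t u + x * (u == z)%:R) *
                     (\sum_v s u v * t v + x * s u z)).
  apply: eq_bigr => u _; rewrite -(sum_delta (fun v => s u v) z) mulr_sumr.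
  rewrite -big_split mulr_sumr; apply: eq_bigr => v _ /=; ring.
transitivity (\sum_u t u * (\sum_v s u v * t v + x * s u z) +
              x * \sum_u (\sum_v s u v * t v + x * s u z) * (u == z)%:R).
  rewrite mulr_sumr -big_split; apply: eq_bigr => u _ /=; ring.
rewrite sum_delta.
transitivity (\sum_u \sum_v t u * s u v * t v + x * (\sum_u t u * s u z) +
              x * (\sum_v s z v * t v + x * s z z)).
  congr +%R; rewrite mulr_sumr -big_split; apply: eq_bigr => u _ /=.
  rewrite mulrDr mulr_sumr; congr +%R; last by ring.
  by apply: eq_bigr => v _; ring.
have -> : \sum_v s z v * t v = \sum_u t u * s u z.
  by apply: eq_bigr => v _; rewrite s_sym mulrC.
by ring.
Qed.

(** Moving [t] by [x] along coordinate [z] gives a quadratic polynomial in [x] that is nonnegative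
    everywhere ([form_bump]). *)
Lemma form_cauchy s t z : psd s ->
  (\sum_u t u * s u z) ^+ 2 <= form s t * s z z.
Proof.
move=> [s_sym s_ge0]; set b := \sum_u _.
have q x : 0 <= form s t + 2 * x * b + x ^+ 2 * s z z.
  by rewrite -form_bump.
have szz : 0 <= s z z.
  by have := s_ge0 (fun u => (u == z)%:R); rewrite form_delta.
have [z0|z0] := eqVneq (s z z) 0; last first.
  (* The minimizer of the quadratic. *)
  have := q (- b / s z z); have -> : form s t + 2 * (- b / s z z) * b +
    (- b / s z z) ^+ 2 * s z z = (form s t * s z z - b ^+ 2) / s z z by field.
  by rewrite pmulr_lge0 ?invr_gt0 ?lt_def ?z0 // subr_ge0.
have [->|b0] := eqVneq b 0; first by rewrite z0 mulr0 expr0n.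
(* Here the polynomial is affine with slope [2 * b]; this point is chosen so that its value is
   [- 1]. *)
have := q (- (form s t + 1) / (2 * b)); rewrite z0 mulr0 addr0.
have -> : form s t + 2 * (- (form s t + 1) / (2 * b)) * b = - 1 by field.
by rewrite oppr_ge0 ler10.
Qed.

Lemma psd_cauchy s u v : psd s -> s u v ^+ 2 <= s u u * s v v.
Proof.
move=> ps; have := form_cauchy (fun x => (x == u)%:R) v ps.
by rewrite form_delta sum_deltal.
Qed.

Lemma psd_diag_ge0 s u : psd s -> 0 <= s u u.
Proof.
by case=> _ /(_ (fun x => (x == u)%:R)); rewrite form_delta.
Qed.

Lemma psd_diag0 s u v : psd s -> s v v = 0 -> s u v = 0.
Proof.
move=> ps v0; apply/eqP; rewrite -sqrf_eq0 eq_le sqr_ge0 andbT.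
by rewrite (le_trans (psd_cauchy u v ps)) // v0 mulr0.
Qed.

(** The Schur complement of the entry at [z]. If [s z z = 0], division by zero leaves [s] unchanged,
    as it should: for positive semidefinite [s] the column of [z] then vanishes. So conditioning
    twice on a vertex is harmless. *)
Definition cond s (z u v : V) : R := s u v - s u z * s z v / s z z.

Lemma form_cond s z t : (forall u v, s u v = s v u) ->
  form (cond s z) t = form s t - (\sum_u t u * s u z) ^+ 2 / s z z.
Proof.
move=> s_sym; rewrite expr2 {1}mulr_suml mulr_suml -sumrB; apply: eq_bigr => u _.
rewrite mulr_sumr mulr_suml -sumrB; apply: eq_bigr => v _.
by rewrite /cond (s_sym z v); ring.
Qed.

Lemma cond_psd s z : psd s -> psd (cond s z).
Proof.
move=> ps; have [s_sym s_ge0] := ps; split=> [u v|t].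
  by rewrite /cond s_sym (s_sym u z) (s_sym z v) (mulrC (s z u)).
rewrite form_cond // subr_ge0; have [z0|z0] := eqVneq (s z z) 0.
  by rewrite z0 invr0 mulr0.
rewrite ler_pdivrMr; first exact: form_cauchy.
by rewrite lt_def z0 psd_diag_ge0.
Qed.

Definition condl s (l : seq V) := foldl cond s l.

Lemma condl_rcons s l z : condl s (rcons l z) = cond (condl s l) z.
Proof. by rewrite /condl foldl_rcons. Qed.

Lemma condl_psd s l : psd s -> psd (condl s l).
Proof.
by move=> ps; elim/last_ind: l => // l z; rewrite condl_rcons; exact: cond_psd.
Qed.

Lemma cond_diag s z u : psd s -> cond s z u z = 0.
Proof.
move=> ps; rewrite /cond; have [z0|z0] := eqVneq (s z z) 0.
  by rewrite (psd_diag0 u ps z0) !mul0r subr0.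
by rewrite mulfK // subrr.
Qed.

Lemma condl_mem0 s l u z : psd s -> z \in l -> condl s l u z = 0.
Proof.
move=> ps; elim/last_ind: l u => // l x IH u; rewrite mem_rcons inE condl_rcons.
have [->|zx /= zl] := eqVneq z x; first by rewrite cond_diag //; exact: condl_psd.
by rewrite /cond !IH // mulr0 mul0r subr0.
Qed.

(** Gram-Schmidt: [c] holds coefficients of a linear regression of [u] on [l], and the conditioned
    entry is the covariance of the residual with [v]. *)
Lemma condl_regression s l u : exists2 c : V -> R,
  forall y, y \notin l -> c y = 0 &
  forall v, condl s l u v = s u v - \sum_y c y * s y v.
Proof.
elim/last_ind: l u => [|l z IH] u.
  exists (fun=> 0) => // v; rewrite big1 ?subr0 // => y _; exact: mul0r.
have [c c0 cE] := IH u; have [d d0 dE] := IH z.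
pose k := condl s l u z / condl s l z z.
(* The new residual is that of [u] minus [k] times that of [z]; the latter is [z] minus its own
   regression [d] on [l]. *)
exists (fun y => c y - k * d y + k * (y == z)%:R) => [y|v].
  rewrite mem_rcons inE negb_or => /andP[/negbTE-> yl].
  by rewrite c0 // d0 // !mulr0 subr0 addr0.
rewrite condl_rcons /cond.
rewrite (_ : _ * _ / _ = k * condl s l z v); last by rewrite /k mulrAC.
have -> : \sum_y (c y - k * d y + k * (y == z)%:R) * s y v =
    \sum_y c y * s y v - k * (\sum_y d y * s y v) + k * s z v.
  rewrite -(sum_deltal (s^~ v)) !mulr_sumr -sumrB -big_split.
  by apply: eq_bigr => y _ /=; ring.
by rewrite cE dE; ring.
Qed.

Definition nonzero (t : V -> R) : Prop := exists v, t v != 0.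

Lemma formZ s (a : R) t : form s (fun v => a * t v) = a ^+ 2 * form s t.
Proof.
rewrite /form mulr_sumr; apply: eq_bigr => u _; rewrite mulr_sumr.
by apply: eq_bigr => v _; ring.
Qed.

Definition biform s (t t' : V -> R) : R := \sum_u \sum_v t u * s u v * t' v.

Lemma biformC s t t' : (forall u v, s u v = s v u) -> biform s t t' = biform s t' t.
Proof.
move=> s_sym; rewrite /biform exchange_big; apply: eq_bigr => u _; apply: eq_bigr => v _.
by rewrite s_sym; ring.
Qed.

Lemma form_addZ s (a : R) t t' : (forall u v, s u v = s v u) ->
  form s (fun v => t v + a * t' v) =
  form s t + 2 * a * biform s t t' + a ^+ 2 * form s t'.
Proof.
move=> s_sym; have -> : 2 * a * biform s t t' = a * biform s t t' + a * biform s t' t.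
  by rewrite (biformC t' t s_sym); ring.
rewrite /form /biform !mulr_sumr -!big_split; apply: eq_bigr => u _ /=.
rewrite !mulr_sumr -!big_split; apply: eq_bigr => v _ /=; ring.
Qed.

Lemma form_gt0_nonzero s t : 0 < form s t -> nonzero t.
Proof.
move=> t_gt0; apply: contrapT => t0; move: t_gt0; rewrite /form big1 ?ltxx // => u _.
rewrite big1 // => v _; have -> : t u = 0; last by rewrite !mul0r.
by apply/eqP/negPn/negP => tu; apply: t0; exists u.
Qed.

End Forms.

Section PartialCovariance.
Variables (R : realType) (V : finType) (sigma : V -> V -> R).
Hypothesis sigma_pos : posdef sigma.

Lemma posdef_psd : psd sigma.
Proof.
case: sigma_pos => s_sym s_gt0; split=> // t.
have [[v tv]|t0] := pselect (exists v, t v != 0); first by apply/ltW/s_gt0; exists v.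
rewrite /form big1 // => u _; rewrite big1 // => v _.
have -> : t u = 0; last by rewrite !mul0r.
by apply/eqP/negPn/negP => tu; apply: t0; exists u.
Qed.

Lemma posdef_diag_neq0 u : sigma u u != 0.
Proof.
case: sigma_pos => _ /(_ (fun x => (x == u)%:R)).
rewrite -/(form _ _) form_delta => h; apply/lt0r_neq0/h.
by exists u; rewrite eqxx oner_neq0.
Qed.

Lemma sub_mx_unit (Z : {set V}) : sub_mx sigma Z \in unitmx.
Proof.
rewrite unitmxE unitfE; apply/negP => /det0P[l l0 lM].
(* A kernel vector of the submatrix, extended by zero to all of [V]; its form would vanish. *)
pose t v := \sum_(i < #|Z|) l 0 i * (v == enum_val i)%:R.
have tE i : t (enum_val i) = l 0 i.
  rewrite -[RHS](sum_delta (l 0)); apply: eq_bigr => j _.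
  by rewrite (inj_eq enum_val_inj) eq_sym.
case: sigma_pos => _ /(_ t) h.
have : 0 < \sum_u \sum_v t u * sigma u v * t v.
  apply: h; apply: contrapT => tz; case/negP: l0; apply/eqP/rowP => i.
  rewrite mxE -tE; apply/eqP/negPn/negP => ti; apply: tz.
  by exists (enum_val i).
suff -> : \sum_u \sum_v t u * sigma u v * t v = 0 by rewrite ltxx.
have tsum (F : V -> R) : \sum_v t v * F v = \sum_i l 0 i * F (enum_val i).
  rewrite (eq_bigr (fun v => \sum_i (v == enum_val i)%:R * (l 0 i * F v))).
    by rewrite exchange_big; apply: eq_bigr => i _; rewrite sum_deltal.
  by move=> v _; rewrite mulr_suml; apply: eq_bigr => i _; ring.
rewrite exchange_big /=.
rewrite (eq_bigr (fun v => t v * \sum_u t u * sigma u v)) => [|v _]; last first.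
  by rewrite mulrC mulr_suml; apply: eq_bigr => u _.
rewrite tsum big1 // => j _; rewrite tsum.
have := congr1 (fun M : 'rV_ _ => M 0 j) lM; rewrite !mxE => lj.
rewrite [X in _ * X](_ : _ = 0) ?mulr0 // -[RHS]lj.
by apply: eq_bigr => i _; rewrite mxE.
Qed.

(** The second hypothesis is the system of normal equations: the row of [u] is [c] times the
    submatrix on [Z], so the inverse matrix cancels. *)
Lemma pcov_regression (Z : {set V}) u (c : V -> R) :
    (forall y, y \notin Z -> c y = 0) ->
    (forall z, z \in Z -> sigma u z = \sum_y c y * sigma y z) ->
  forall v, pcov sigma u v Z = sigma u v - \sum_y c y * sigma y v.
Proof.
move=> c0 cE v; rewrite /pcov.
have csum x : \sum_y c y * sigma y x =
    \sum_(i < #|Z|) c (enum_val i) * sigma (enum_val i) x.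
  rewrite (bigID (mem Z)) /= [X in _ + X]big1 => [|y /c0 ->]; last by rewrite mul0r.
  by rewrite addr0 big_enum_val.
have -> : sub_row sigma u Z = (\row_i c (enum_val i)) *m sub_mx sigma Z.
  apply/rowP => j; rewrite !mxE cE ?enum_valP // csum.
  by apply: eq_bigr => i _; rewrite !mxE.
rewrite mulmxK ?sub_mx_unit // !mxE csum; congr (_ - _).
by apply: eq_bigr => i _; rewrite !mxE.
Qed.

(** Conditioning annihilates the columns of [l], which is exactly the normal equations for the
    regression coefficients. Hence the order and repetitions in [l] do not matter, which later
    allows lists to be rearranged. *)
Lemma pcov_condl (Z : {set V}) (l : seq V) u v :
  l =i Z -> pcov sigma u v Z = condl sigma l u v.
Proof.
move=> lZ; have [c c0 cE] := condl_regression sigma l u.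
rewrite cE; apply: pcov_regression => [y|z]; rewrite -lZ; first exact: c0.
move=> zl; apply/eqP; rewrite -subr_eq0 -cE; apply/eqP/condl_mem0 => //.
exact: posdef_psd.
Qed.

End PartialCovariance.

(** * Markov covariances on a tree *)

Section TreeMarkov.
Variables (R : realFieldType) (V : finType) (e : rel V).
Hypothesis tree_e : is_tree e.
Implicit Types (s : V -> V -> R).

(* If [w] has been conditioned on, then [s w w = 0] and the division by zero
   makes this say [s u v = 0]. *)
Definition tree_markov s : Prop :=
  forall w u v, cuts e w u v -> s u v = s u w * s w v / s w w.

Definition sqcorr s u v : R := s u v ^+ 2 / (s u u * s v v).

(** As [w] separates [v] from [u] and from [z], the column of [v] is [b] times the column of [w] in
    the rows [u], [z] and [w]. The Schur complement at [z] preserves this proportionality. *)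
Lemma cond_tree_markov_half s z w u v : psd s -> tree_markov s ->
  cuts e w u v -> cuts e w z v ->
  cond s z u v = cond s z u w * cond s z w v / cond s z w w.
Proof.
move=> ps ms wuv wzv; have [s_sym _] := ps.
pose b := s w v / s w w.
have su : s u v = s u w * b by rewrite (ms w) // mulrA.
have sz : s z v = s z w * b by rewrite (ms w) // mulrA.
have sw : s w v = s w w * b.
  have [w0|w0] := eqVneq (s w w) 0; last by rewrite /b mulrC divfK.
  by rewrite w0 mul0r s_sym (psd_diag0 v ps w0).
have cE x : s x v = s x w * b -> cond s z x v = cond s z x w * b.
  by move=> xE; rewrite /cond xE sz; ring.
rewrite (cE u su) (cE w sw); have [w0|w0] := eqVneq (cond s z w w) 0; last by field.
by rewrite (psd_diag0 u (cond_psd z ps) w0) !mul0r.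
Qed.

Lemma cond_tree_markov s z : psd s -> tree_markov s -> tree_markov (cond s z).
Proof.
move=> ps ms w u v wuv; have [e_sym _ _ _] := tree_e.
have [wzu|wzv] := orP (cuts_split e_sym z wuv); last exact: cond_tree_markov_half.
have [c_sym _] := cond_psd z ps.
rewrite c_sym (cond_tree_markov_half ps ms _ wzu) 1?cuts_sym //.
by rewrite (c_sym v) (c_sym w u) [X in X / _]mulrC.
Qed.

Lemma condl_tree_markov s l : psd s -> tree_markov s -> tree_markov (condl s l).
Proof.
move=> ps ms; elim/last_ind: l => // l z IH; rewrite condl_rcons.
by apply: cond_tree_markov => //; exact: condl_psd.
Qed.

Lemma sqcorr_ge0 s u v : psd s -> 0 <= sqcorr s u v.
Proof. by move=> ps; rewrite divr_ge0 ?sqr_ge0 // mulr_ge0 // psd_diag_ge0. Qed.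

(** The squared correlation factors as that of [a], [c] times that of [c], [c'], and the second
    factor is at most 1. Degenerate variances make the left side 0 by the division convention. *)
Lemma sqcorr_cuts s a c c' : psd s -> tree_markov s -> cuts e c a c' ->
  sqcorr s a c' <= sqcorr s a c.
Proof.
move=> ps ms cc; have [c0|c0] := eqVneq (s c c) 0.
  rewrite {1}/sqcorr (ms c) // c0 invr0 mulr0 expr0n mul0r.
  exact: sqcorr_ge0.
have [c0'|c0'] := eqVneq (s c' c') 0.
  by rewrite {1}/sqcorr c0' mulr0 invr0 mulr0 sqcorr_ge0.
have cp : 0 < s c c by rewrite lt_def c0 psd_diag_ge0.
have cp' : 0 < s c' c' by rewrite lt_def c0' psd_diag_ge0.
have -> : sqcorr s a c' =
    sqcorr s a c * (s c c' ^+ 2 / (s c c * s c' c')).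
  rewrite /sqcorr (ms c) // !invfM; move: (s a a)^-1 => x.
  by field; rewrite c0 c0'.
rewrite ler_piMr ?sqcorr_ge0 //.
by rewrite ler_pdivrMr ?mulr_gt0 // mul1r psd_cauchy.
Qed.

(** Since [p] is the median of [a], [c] and [z], conditioning on [z] acts only through [p]: the
    squared covariance shrinks by [(1 - t) ^+ 2], while each variance shrinks by a factor no smaller
    than [1 - t]. *)
Lemma sqcorr_cond s a c p z : psd s -> tree_markov s ->
  cuts e p a c -> cuts e p z a -> cuts e p z c ->
  sqcorr (cond s z) a c <= sqcorr s a c.
Proof.
move=> ps ms pac pza pzc; have [s_sym _] := ps; have pc := cond_psd z ps.
have sq0 := sqcorr_ge0 a c ps.
have [z0|z0] := eqVneq (s z z) 0.
  by rewrite /sqcorr /cond z0 invr0 !mulr0 !subr0.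
have [p0|p0] := eqVneq (s p p) 0.
  rewrite /sqcorr /cond (s_sym a z) (ms _ _ _ pac) (ms _ _ _ pza) p0 invr0 !mulr0.
  by rewrite !mul0r subr0 expr0n !mul0r.
have [a0|a0] := eqVneq (cond s z a a) 0.
  by rewrite {1}/sqcorr a0 mul0r invr0 mulr0.
have [c0|c0] := eqVneq (cond s z c c) 0.
  by rewrite {1}/sqcorr c0 mulr0 invr0 mulr0.
have zp : 0 < s z z by rewrite lt_def z0 psd_diag_ge0.
have pp : 0 < s p p by rewrite lt_def p0 psd_diag_ge0.
have ap : 0 < cond s z a a by rewrite lt_def a0 psd_diag_ge0.
have cp : 0 < cond s z c c by rewrite lt_def c0 psd_diag_ge0.
(* [x] and [y] are the parts of the variances of [a] and [c] explained by [p]; [t] is the squared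
   correlation of [z] and [p]. *)
pose x := s a p ^+ 2 / s p p; pose y := s p c ^+ 2 / s p p.
pose t := s z p ^+ 2 / (s p p * s z z).
have t0 : 0 <= t by rewrite divr_ge0 ?sqr_ge0 // ltW // mulr_gt0.
have t1 : t <= 1.
  by rewrite ler_pdivrMr ?mulr_gt0 // mul1r mulrC psd_cauchy.
have x0 : 0 <= x by rewrite divr_ge0 ?sqr_ge0 // ltW.
have y0 : 0 <= y by rewrite divr_ge0 ?sqr_ge0 // ltW.
have xa : x <= s a a by rewrite ler_pdivrMr // psd_cauchy.
have yc : y <= s c c by rewrite ler_pdivrMr // mulrC psd_cauchy.
have aE : cond s z a a = s a a - x * t.
  by rewrite /cond (s_sym a z) (ms _ _ _ pza) (s_sym p a) /x /t; field; rewrite ?p0 ?z0.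
have cE : cond s z c c = s c c - y * t.
  by rewrite /cond (s_sym c z) (ms _ _ _ pzc) /y /t; field; rewrite ?p0 ?z0.
have acE : cond s z a c ^+ 2 = x * y * (1 - t) ^+ 2.
  rewrite /cond (s_sym a z) (ms _ _ _ pza) (ms _ _ _ pzc) (ms _ _ _ pac) (s_sym p a).
  by rewrite /x /y /t; field; rewrite ?p0 ?z0.
have sacE : s a c ^+ 2 = x * y.
  by rewrite (ms _ _ _ pac) /x /y; field; rewrite ?p0 ?z0.
have aa : 0 < s a a.
  by rewrite (lt_le_trans ap) // aE lerBlDr lerDl mulr_ge0.
have cc : 0 < s c c.
  by rewrite (lt_le_trans cp) // cE lerBlDr lerDl mulr_ge0.
clearbody x y t.
rewrite /sqcorr acE sacE aE cE in ap cp *.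
have xy0 : 0 <= x * y by exact: mulr_ge0.
rewrite -[leLHS]mulrA; apply: ler_wpM2l => //.
rewrite ler_pdivrMr ?mulr_gt0 // [leRHS]mulrC ler_pdivlMr ?mulr_gt0 //.
have -> : (1 - t) ^+ 2 * (s a a * s c c) = (s a a * (1 - t)) * (s c c * (1 - t)) by ring.
(* Uses [x <= s a a]: the explained part of a variance does not exceed it. *)
have h1 : s a a * (1 - t) <= s a a - x * t.
  by rewrite mulrBr mulr1 lerD2l lerN2 ler_wpM2r.
have h2 : s c c * (1 - t) <= s c c - y * t.
  by rewrite mulrBr mulr1 lerD2l lerN2 ler_wpM2r.
by apply: ler_pM => //; apply: mulr_ge0; rewrite ?subr_ge0 // ltW.
Qed.

Lemma sqcorr_condl_le s a c l l' : psd s -> tree_markov s ->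
  sqcorr (condl s (l ++ l')) a c <= sqcorr (condl s l) a c.
Proof.
move=> ps ms; elim/last_ind: l' => [|l' z IH]; first by rewrite cats0.
apply: le_trans IH; rewrite -rcons_cat condl_rcons.
have [e_sym e_irr e_conn e_acyclic] := tree_e.
have [p [? ? ?]] := tree_median e_sym e_irr e_conn e_acyclic a c z.
by apply: (@sqcorr_cond _ _ _ p); [exact: condl_psd|exact: condl_tree_markov|..].
Qed.

Lemma sqcorr_condl_separated s a c l l' : psd s -> tree_markov s ->
    (forall z, z \in l' -> exists2 w, w \in l & cuts e w a z) ->
    (forall z, z \in l' -> exists2 w, w \in l & cuts e w c z) ->
  sqcorr (condl s (l ++ l')) a c = sqcorr (condl s l) a c.
Proof.
move=> ps ms; elim/last_ind: l' => [|l' z IH] ha hc; first by rewrite cats0.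
rewrite -IH; first last.
- by move=> x xl; apply: hc; rewrite mem_rcons inE xl orbT.
- by move=> x xl; apply: ha; rewrite mem_rcons inE xl orbT.
(* The separating vertex [w] is already conditioned on, so its column is zero and the Markov
   relation makes the covariance of [x] and [z] vanish. *)
have h0 x : (exists2 w, w \in l & cuts e w x z) -> condl s (l ++ l') x z = 0.
  case=> w wl wxz; rewrite (condl_tree_markov _ ps ms wxz).
  by rewrite condl_mem0 ?mul0r // mem_cat wl.
have zl : z \in rcons l' z by rewrite mem_rcons mem_head.
have ha0 := h0 _ (ha z zl).
have hc0 := h0 _ (hc z zl).
by rewrite -rcons_cat condl_rcons /sqcorr /cond ha0 hc0 !mul0r !subr0.
Qed.

End TreeMarkov.

(** * Integrals against a density *)

(** Reduces the positive part of a product to products of nonnegative factors, so that signed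
    integrands can be treated by monotone convergence. *)
Lemma maxr0M (R : realDomainType) (x y : R) :
  Num.max (x * y) 0 =
  Num.max y 0 * Num.max x 0 + Num.max (- y) 0 * Num.max (- x) 0.
Proof.
have pos (z : R) : 0 <= z -> (Num.max z 0 = z) * (Num.max (- z) 0 = 0).
  by move=> z0; rewrite max_l // max_r // oppr_le0.
have neg (z : R) : z <= 0 -> (Num.max z 0 = 0) * (Num.max (- z) 0 = - z).
  by move=> z0; rewrite max_r // max_l // oppr_ge0.
have [x0|/ltW x0] := leP 0 x; have [y0|/ltW y0] := leP 0 y.
- by rewrite !pos // ?mulr_ge0 //; ring.
- by rewrite (neg _ (mulr_ge0_le0 x0 y0)) !(pos _ x0) !(neg _ y0); ring.
- by rewrite (neg _ (mulr_le0_ge0 x0 y0)) !(neg _ x0) !(pos _ y0); ring.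
- by rewrite (pos _ (mulr_le0 x0 y0)) !(neg _ x0) !(neg _ y0); ring.
Qed.

Section Density.
Local Open Scope ereal_scope.
Context d (T : measurableType d) (R : realType).
Variable mu : {measure set T -> \bar R}.

Section IntegralDensity.
Import HBNNSimple.
Variables (nu : {measure set T -> \bar R}) (g : T -> R).
Hypotheses (mg : measurable_fun setT g) (g_ge0 : forall x, (0 <= g x)%R).
Hypothesis nuE : forall A : set T, measurable A -> nu A = \int[mu]_(x in A) (g x)%:E.

(** For simple functions this is [nuE] and linearity; monotone convergence along simple
    approximations of [f] does the rest. *)
Lemma ge0_integral_density (f : T -> R) :
    measurable_fun setT f -> (forall x, (0 <= f x)%R) ->
  \int[nu]_x (f x)%:E = \int[mu]_x (f x * g x)%:E.
Proof.
move=> mf f0.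
have mf' : measurable_fun setT (fun x => (f x)%:E) by exact/measurable_EFinP.
pose h := nnsfun_approx measurableT mf'.
have hf x : (h n x)%:E @[n --> \oo] --> (f x)%:E.
  by apply: (cvg_nnsfun_approx measurableT mf') => //= y _; rewrite lee_fin.
have mh n : measurable_fun setT (h n) by [].
transitivity (lim (\int[nu]_x (h n x)%:E @[n --> \oo])).
  rewrite -monotone_convergence //.
  - by apply: eq_integral => x _; apply/esym/cvg_lim => //; exact: hf.
  - by move=> n; exact/measurable_EFinP.
  - by move=> n x _; rewrite lee_fin.
  - by move=> x _ m n mn; rewrite lee_fin; exact/lefP/nd_nnsfun_approx.
transitivity (lim (\int[mu]_x (h n x * g x)%:E @[n --> \oo])); last first.
  rewrite -monotone_convergence //.
  - apply: eq_integral => x _; apply/cvg_lim => //; under eq_fun do rewrite EFinM.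
    by rewrite EFinM; apply: cvgeZr => //; exact: hf.
  - by move=> n; apply/measurable_EFinP; exact: measurable_funM.
  - by move=> n x _; rewrite lee_fin mulr_ge0.
  - by move=> x _ m n mn; rewrite lee_fin ler_wpM2r //; exact/lefP/nd_nnsfun_approx.
apply: congr_lim; apply/funext => n.
transitivity (\int[nu]_x
   (\sum_(y \in range (h n)) (y * \1_(h n @^-1` [set y]) x)%:E)).
  by apply: eq_integral => t tE; rewrite /= fimfunE -fsumEFin.
have indich r : measurable_fun setT (fun x => (r * \1_(h n @^-1` [set r]) x)%:E).
  by apply/measurable_EFinP; exact: measurable_funM.
rewrite ge0_integral_fsum //; last by move=> y x _; exact: nnfun_muleindic_ge0.
transitivity (\int[mu]_x (\sum_(y \in range (h n))
    (y * \1_(h n @^-1` [set y]) x)%:E * (g x)%:E)); last first.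
  under eq_integral => x _.
    rewrite -ge0_mule_fsuml => [|y]; last exact: nnfun_muleindic_ge0.
    rewrite fsumEFin // -(fimfunE _ x) -EFinM; over.
  by [].
have mg' : measurable_fun setT (fun x => (g x)%:E) by exact/measurable_EFinP.
rewrite ge0_integral_fsum //; last 2 first.
  - by move=> y; exact: emeasurable_funM.
  - by move=> y x _; apply: mule_ge0; [exact: nnfun_muleindic_ge0|rewrite lee_fin].
apply: eq_fsbigr => r rhn.
under [LHS]eq_integral do rewrite EFinM.
rewrite integralZl_indic_nnsfun //.
under [RHS]eq_integral do rewrite EFinM -muleA.
rewrite ge0_integralZl //.
- under [in RHS]eq_integral do rewrite muleC.
  rewrite [in RHS](eq_integral ((EFin \o g) \_ (h n @^-1` [set r]))); last first.
    by move=> x xE; rewrite epatch_indic.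
  by rewrite -integral_mkcond -nuE // integral_indic // setIT.
- by apply: emeasurable_funM => //; exact/measurable_EFinP.
- by move=> x _; rewrite mule_ge0 ?lee_fin.
- by case/set_mem: rhn => x _ <-; rewrite lee_fin.
Qed.

End IntegralDensity.

Section DensityMeasure.
Variable g : T -> R.
Hypotheses (mg : measurable_fun setT g) (g_ge0 : forall x, (0 <= g x)%R).

(** The two proofs are arguments so that a measure instance can be attached to
    [density mg g_ge0]. *)
Definition density (_ : measurable_fun setT g) (_ : forall x, (0 <= g x)%R)
  (A : set T) : \bar R := \int[mu]_(x in A) (g x)%:E.

Local Notation nu := (density mg g_ge0).

Let density0 : nu set0 = 0.
Proof. by rewrite /density integral_set0. Qed.

Let density_ge0 A : 0 <= nu A.
Proof. by apply: integral_ge0 => x _; rewrite lee_fin. Qed.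

Let density_sigma_additive : semi_sigma_additive nu.
Proof.
move=> F mF tF mUF; rewrite /density; apply: cvg_toP.
  apply: ereal_nondecreasing_is_cvgn => m n mn.
  apply: lee_sum_nneg_natr => // k _ _.
  by apply: integral_ge0 => x _; rewrite lee_fin.
rewrite ge0_integral_bigcup //.
- by apply: measurable_funTS; exact/measurable_EFinP.
- by move=> x _; rewrite lee_fin.
Qed.

HB.instance Definition _ := isMeasure.Build _ _ _ nu
  density0 density_ge0 density_sigma_additive.

End DensityMeasure.

(** The last hypothesis says that the measures with densities [Y^\+] and [Y^\-] have the same image
    under [h]; hence they give equal integrals to every nonnegative function of [h]. *)
Lemma integral_mul_preimage_eq0 (Y h : T -> R) :
    measurable_fun setT h -> mu.-integrable setT (EFin \o Y) ->
    mu.-integrable setT (fun x => (Y x * h x)%:E) ->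
    (forall B : set R, measurable B -> \int[mu]_(x in h @^-1` B) (Y x)%:E = 0) ->
  \int[mu]_x (Y x * h x)%:E = 0.
Proof.
move=> mh iY iYh Y0.
have mY : measurable_fun setT Y by exact/measurable_EFinP/(measurable_int mu).
have mYp : measurable_fun setT (Y^\+)%R by exact: measurable_funrpos.
have mYn : measurable_fun setT (Y^\-)%R by exact: measurable_funrneg.
have Yp0 x : (0 <= Y^\+ x)%R by exact: funrpos_ge0.
have Yn0 x : (0 <= Y^\- x)%R by exact: funrneg_ge0.
pose nup := density mYp Yp0; pose nun := density mYn Yn0.
have mhB (B : set R) : measurable B -> measurable (h @^-1` B).
  by move=> mB; rewrite -[_ @^-1` _]setTI; exact: mh.
have iYp D : measurable D -> mu.-integrable D (EFin \o Y^\+%R).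
  by move=> mD; apply: integrableS (integrable_funrpos measurableT iY).
have iYn D : measurable D -> mu.-integrable D (EFin \o Y^\-%R).
  by move=> mD; apply: integrableS (integrable_funrneg measurableT iY).
have nuE (B : set R) : measurable B ->
    pushforward nup h B = pushforward nun h B.
  move=> /[dup] /Y0 YB0 /mhB mB; rewrite /pushforward /nup /nun /density.
  have finYp := integrable_fin_num mB (iYp _ mB).
  have finYn := integrable_fin_num mB (iYn _ mB).
  apply/eqP; rewrite -[X in _ == X]add0e -sube_eq ?fin_num_adde_defl //.
  rewrite -integralB_EFin ?iYp ?iYn // -YB0; apply/eqP/eq_integral => x _.
  by rewrite -[in RHS](funrposBneg Y).
have hE (f : R -> R) : measurable_fun setT f -> (forall x, (0 <= f x)%R) ->
    \int[mu]_x (f (h x) * Y^\+%R x)%:E = \int[mu]_x (f (h x) * Y^\-%R x)%:E.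
  move=> mf f0.
  have mfh : measurable_fun setT (fun x => f (h x)) by exact: (measurableT_comp mf mh).
  have dE (g : T -> R) (mg : measurable_fun setT g) (g0 : forall x, (0 <= g x)%R) :
      \int[density mg g0]_x (f (h x))%:E = \int[mu]_x (f (h x) * g x)%:E.
    by apply: ge0_integral_density => // x; exact: f0.
  rewrite -(dE _ mYp Yp0) -(dE _ mYn Yn0).
  have pE (nu : {measure set T -> \bar R}) :
      \int[nu]_x (f (h x))%:E = \int[pushforward nu h]_y (f y)%:E.
    rewrite [RHS](ge0_integral_pushforward mh) //; first exact/measurable_EFinP.
    by move=> y _; rewrite lee_fin.
  rewrite !pE; apply: eq_measure_integral => B mB _; exact: nuE.
have mp : measurable_fun setT (fun x : R => Num.max x 0%R) by exact: measurable_maxr.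
have mn : measurable_fun setT (fun x : R => Num.max (- x)%R 0%R).
  by apply: measurable_maxr => //; exact: measurable_oppr.
have p0 (x : R) : (0 <= Num.max x 0)%R by rewrite le_max lexx orbT.
have Ep := hE _ mp p0; have En := hE _ mn (fun x => p0 (- x)%R).
have mph : measurable_fun setT (fun x => Num.max (h x) 0%R).
  exact: (measurableT_comp mp mh).
have mnh : measurable_fun setT (fun x => Num.max (- h x)%R 0%R).
  exact: (measurableT_comp mn mh).
have splitE (a b : T -> R) : measurable_fun setT a -> measurable_fun setT b ->
    (forall x, 0 <= a x)%R -> (forall x, 0 <= b x)%R ->
    \int[mu]_x (Num.max (h x) 0 * a x + Num.max (- h x) 0 * b x)%:E =
    \int[mu]_x (Num.max (h x) 0 * a x)%:E + \int[mu]_x (Num.max (- h x) 0 * b x)%:E.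
  move=> ma mb a0 b0; under eq_integral do rewrite EFinD.
  rewrite ge0_integralD //.
  - by move=> x _; rewrite lee_fin mulr_ge0.
  - by apply/measurable_EFinP; exact: measurable_funM.
  - by move=> x _; rewrite lee_fin mulr_ge0.
  - by apply/measurable_EFinP; exact: measurable_funM.
(* The negative part is [h^+ Y^- + h^- Y^+], the positive part [h^+ Y^+ + h^- Y^-]; [Ep] and [En]
   exchange [Y^+] and [Y^-] in each term. *)
have fE : \int[mu]_x (fun x => (Y x * h x)%:E)^\- x =
          \int[mu]_x (fun x => (Y x * h x)%:E)^\+ x.
  transitivity (\int[mu]_x
      (Num.max (h x) 0 * Y^\-%R x + Num.max (- h x) 0 * Y^\+%R x)%:E).
    apply: eq_integral => x _; rewrite funenegE -EFinN -EFin_max -mulNr maxr0M.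
    by rewrite opprK.
  rewrite splitE // -Ep En -splitE //.
  apply: eq_integral => x _; by rewrite funeposE -EFin_max maxr0M.
by rewrite (integralE mu _ (fun x => (Y x * h x)%:E)) fE subee // integrable_pos_fin_num.
Qed.

Lemma eq_integral_mul_preimage (Y Z h : T -> R) :
    measurable_fun setT h ->
    mu.-integrable setT (EFin \o Y) -> mu.-integrable setT (EFin \o Z) ->
    mu.-integrable setT (fun x => (Y x * h x)%:E) ->
    mu.-integrable setT (fun x => (Z x * h x)%:E) ->
    (forall B : set R, measurable B ->
      \int[mu]_(x in h @^-1` B) (Y x)%:E = \int[mu]_(x in h @^-1` B) (Z x)%:E) ->
  \int[mu]_x (Y x * h x)%:E = \int[mu]_x (Z x * h x)%:E.
Proof.
move=> mh iY iZ iYh iZh YZ.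
have finZh := integrable_fin_num measurableT iZh.
apply/eqP; rewrite -[X in _ == X]add0e -sube_eq ?fin_num_adde_defl //; last first.
  exact: integrable_fin_num iYh.
rewrite -integralB_EFin //; apply/eqP.
transitivity (\int[mu]_x ((Y x - Z x) * h x)%:E).
  by apply: eq_integral => x _; rewrite -EFinB mulrBl.
apply: integral_mul_preimage_eq0 => //.
- exact: (integrableB measurableT iY iZ).
- under eq_fun do rewrite mulrBl EFinB; exact: integrableB.
move=> B mB; have mhB : measurable (h @^-1` B).
  by rewrite -[_ @^-1` _]setTI; exact: mh.
under eq_integral do rewrite EFinB.
have iZB : mu.-integrable (h @^-1` B) (EFin \o Z) by exact: integrableS iZ.
rewrite integralB_EFin // ?YZ ?subee //; last exact: integrableS iY.
exact: integrable_fin_num iZB.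
Qed.

End Density.

(** * The normal law *)

Section NormalLaw.
Context (R : realType).
Local Notation leb := (@lebesgue_measure R).
Local Open Scope ereal_scope.

Lemma lebesgue_measure_shift (c : R) (A : set R) : measurable A ->
  pushforward leb (fun x : R => (x + c)%R : measurableTypeR R) A = leb A.
Proof.
move=> mA; have mc : measurable_fun [set: measurableTypeR R]
    (fun x : R => (x + c)%R : measurableTypeR R) by exact: measurable_funD.
pose mc' := isMeasurableFun.Build _ _ _ _ _ mc.
apply/esym/lebesgue_measure_unique => //= _ [[a b]] _ <-.
rewrite /pushforward (_ : _ @^-1` _ = `](a - c)%R, (b - c)%R]%classic); last first.
  by apply/seteqP; split => x /=; rewrite !in_itv /= ltrBlDr lerBrDr.
rewrite !lebesgue_measure_itv /= !lte_fin ltrD2r.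
by case: ifP => // _; rewrite -!EFinB; congr EFin; ring.
Qed.

Lemma normal_prob_shift (c m s : R) (B : set R) : s != 0%R -> measurable B ->
  normal_prob m s ((fun x => x + c)%R @^-1` B) = normal_prob (m + c) s B.
Proof.
move=> s0 mB; have mc : measurable_fun [set: measurableTypeR R]
    (fun x : R => (x + c)%R : measurableTypeR R) by exact: measurable_funD.
rewrite /normal_prob -[RHS](@eq_measure_integral _ _ _ _ _
  (pushforward leb (fun x : R => (x + c)%R : measurableTypeR R))); last first.
  by move=> A mA _; exact: lebesgue_measure_shift.
rewrite (ge0_integral_pushforward mc) //.
- apply: eq_integral => x _ /=; congr EFin.
  by rewrite !normal_pdfE // /normal_fun; congr (_ * expR _)%R; congr (_ / _)%R; ring.
- by apply/measurable_EFinP; apply: measurable_funTS; exact: measurable_normal_pdf.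
- by move=> x _; rewrite lee_fin normal_pdf_ge0.
Qed.

Lemma normal_prob_set1 (m s c : R) : normal_prob m s [set c] = 0.
Proof.
have := normal_prob_dominates m s; rewrite null_content_dominatesP => ->//.
exact: lebesgue_measure_set1.
Qed.

(** The factor common to the second moments of all centered normal laws; being finite and nonzero,
    it can be cancelled. *)
Definition std_second_moment : \bar R := \int[normal_prob 0 1]_x (x ^+ 2)%:E.

Lemma std_second_momentE :
  std_second_moment = \int[leb]_x (x ^+ 2 * normal_pdf 0 1 x)%:E.
Proof.
apply: ge0_integral_density => //.
- exact: measurable_normal_pdf.
- by move=> x; exact: normal_pdf_ge0.
- by move=> x; exact: sqr_ge0.
Qed.

Lemma std_second_moment_lty : std_second_moment < +oo.
Proof.
rewrite std_second_momentE.
have s2 : (Num.sqrt 2 : R) != 0%R by rewrite sqrtr_eq0 -ltNge ltr0n.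
(* The integrand is dominated by [C] times the normal density of variance 2: [1 + y <= expR y] at
   [y = x ^+ 2 / 4] gives [x ^+ 2 <= 4 * expR (x ^+ 2 / 4)], and the peaks adjust the
   normalization. *)
pose C : R := (4 * (normal_peak 1 / normal_peak (Num.sqrt 2)))%R.
have C0 : (0 <= C)%R by rewrite mulr_ge0 // divr_ge0 // normal_peak_ge0.
apply: (@le_lt_trans _ _
  (\int[leb]_x (C%:E * (normal_pdf 0 (Num.sqrt 2) x)%:E))); last first.
  rewrite ge0_integralZl //; last 2 first.
    by apply/measurable_EFinP; exact: measurable_normal_pdf.
    by move=> x _; rewrite lee_fin normal_pdf_ge0.
  by rewrite integral_normal_pdf mule1 ltry.
apply: ge0_le_integral => //.
- by move=> x _; rewrite lee_fin mulr_ge0 ?sqr_ge0 ?normal_pdf_ge0.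
- apply/measurable_EFinP; apply: measurable_funM; first exact: exprn_measurable.
  exact: measurable_normal_pdf.
- by apply/measurable_EFinP; apply: measurable_funM => //; exact: measurable_normal_pdf.
move=> /= x _; rewrite lee_fin !normal_pdfE ?oner_neq0 // /normal_fun !subr0 sqr_sqrtr //.
rewrite expr1n /C; set p1 := normal_peak 1; set p2 := normal_peak _.
have p2_neq0 : p2 != 0%R by rewrite gt_eqF // normal_peak_gt0.
have -> : (4 * (p1 / p2) * (p2 * expR (- x ^+ 2 / (2 *+ 2))) =
           p1 * (4 * expR (- x ^+ 2 / (2 *+ 2))))%R by field.
rewrite mulrCA ler_wpM2l ?normal_peak_ge0 //.
have -> : (- x ^+ 2 / 2 = - x ^+ 2 / (2 *+ 2) + - x ^+ 2 / (2 *+ 2))%R by field.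
rewrite expRD mulrA ler_wpM2r ?expR_ge0 // mulNr expRN.
rewrite ler_pdivrMr ?expR_gt0 //.
have := expR_ge1Dx (x ^+ 2 / (2 *+ 2)); lra.
Qed.

(** A zero second moment would concentrate the law at 0, but a normal law has no atoms. *)
Lemma std_second_moment_gt0 : 0 < std_second_moment.
Proof.
rewrite lt_def integral_ge0 ?andbT; last by move=> x _; rewrite lee_fin sqr_ge0.
apply/negP => /eqP; rewrite /std_second_moment => k0.
pose nu : probability _ R := normal_prob (0 : R) 1.
have : \int[nu]_x `|(x ^+ 2)%:E| = 0.
  rewrite -[RHS]k0; apply: eq_integral => x _.
  by rewrite gee0_abs // lee_fin sqr_ge0.
case/(ae_eq_integral_abs _ measurableT) => [|N [mN N0 subN]].
  by apply/measurable_EFinP; exact: exprn_measurable.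
have : nu setT <= nu (N `|` [set 0%R]).
  apply: le_measure; rewrite ?inE //; first exact: measurableU.
  move=> x _; have [->|x0] := eqVneq x 0%R; first by right.
  left; apply: subN => /= /(_ I) /eqP; rewrite eqe expf_eq0 /=.
  by apply/negP.
rewrite probability_setT measureU0 //; last exact: normal_prob_set1.
by rewrite N0 lee_fin ler10.
Qed.

End NormalLaw.

(** * Uncorrelated linear combinations of a Gaussian vector *)

Section GaussianField.
Context d (Omega : measurableType d) (R : realType) (P : probability Omega R).
Variables (V : finType) (X : V -> {RV P >-> R}) (mu : V -> R) (sigma : V -> V -> R).
Hypothesis sigma_pos : posdef sigma.
Hypothesis X_gauss : gaussian_vector X mu sigma.
Local Open Scope ereal_scope.

Definition lincomb (t : V -> R) (w : Omega) : R := (\sum_v t v * (X v w - mu v))%R.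

Lemma measurable_lincomb t : measurable_fun setT (lincomb t).
Proof.
apply: measurable_sum => v; apply: measurable_funM => //.
by apply: measurable_funB => //; exact: measurable_funPT.
Qed.
Hint Resolve measurable_lincomb : core.

Lemma lincombD a t t' w :
  lincomb (fun v => t v + a * t' v)%R w = (lincomb t w + a * lincomb t' w)%R.
Proof. by rewrite /lincomb mulr_sumr -big_split; apply: eq_bigr => v _ /=; ring. Qed.

Lemma lincombZ a t w : lincomb (fun v => a * t v)%R w = (a * lincomb t w)%R.
Proof. by rewrite /lincomb mulr_sumr; apply: eq_bigr => v _ /=; ring. Qed.

Lemma lincomb_delta v w : lincomb (fun u => (u == v)%:R) w = (X v w - mu v)%R.
Proof. by rewrite /lincomb sum_deltal. Qed.

Lemma form_gt0 t : nonzero t -> (0 < form sigma t)%R.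
Proof. by move=> /(sigma_pos.2 t). Qed.

Lemma law_lincomb t (B : set R) : nonzero t -> measurable B ->
  P (lincomb t @^-1` B) = normal_prob 0 (Num.sqrt (form sigma t)) B.
Proof.
move=> t0 mB; pose m := (\sum_v t v * mu v)%R.
have s0 : Num.sqrt (form sigma t) != 0%R by rewrite gt_eqF // sqrtr_gt0 form_gt0.
rewrite -[X in normal_prob X](addrN m) -normal_prob_shift //.
rewrite -(X_gauss t0) //; last first.
  have mm : measurable_fun setT (fun x : R => x + - m)%R by exact: measurable_funD.
  by rewrite -[_ @^-1` _]setTI; exact: mm.
congr (P _); apply/seteqP; split=> w /=; rewrite /lincomb /m -sumrB.
  by rewrite (eq_bigr (fun v => t v * X v w - t v * mu v)%R) // => v _; ring.
by rewrite (eq_bigr (fun v => t v * (X v w - mu v))%R) // => v _; ring.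
Qed.

Lemma ge0_integral_lincomb t (f : R -> R) : nonzero t ->
    measurable_fun setT f -> (forall x, 0 <= f x)%R ->
  \int[P]_w (f (lincomb t w))%:E =
  \int[normal_prob 0 (Num.sqrt (form sigma t))]_x (f x)%:E.
Proof.
move=> t0 mf f0; pose L : Omega -> measurableTypeR R := lincomb t.
have mL : measurable_fun setT L by exact: measurable_lincomb.
pose fE : measurableTypeR R -> \bar R := fun x => (f x)%:E.
have mf' : measurable_fun setT fE by exact/measurable_EFinP.
transitivity (\int[pushforward P L]_x fE x).
  by rewrite (ge0_integral_pushforward mL) // => x _; rewrite lee_fin.
by apply: eq_measure_integral => B mB _; exact: law_lincomb.
Qed.

Lemma same_law_lincomb t t' (f : R -> R) : nonzero t -> nonzero t' ->
    form sigma t = form sigma t' ->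
    measurable_fun setT f -> (forall x, 0 <= f x)%R ->
  \int[P]_w (f (lincomb t w))%:E = \int[P]_w (f (lincomb t' w))%:E.
Proof.
move=> t0 t0' tt' mf f0; transitivity (
    \int[normal_prob 0 (Num.sqrt (form sigma t))]_x (f x)%:E).
  exact: ge0_integral_lincomb.
by rewrite tt'; symmetry; exact: ge0_integral_lincomb.
Qed.

Lemma lincomb_set1 t c : nonzero t -> P (lincomb t @^-1` [set c]) = 0.
Proof. by move=> t0; rewrite law_lincomb // normal_prob_set1. Qed.

Lemma second_moment_lincomb t : nonzero t ->
  \int[P]_w (lincomb t w ^+ 2)%:E = (form sigma t)%:E * std_second_moment R.
Proof.
move=> t0; have ft := form_gt0 t0; set s := Num.sqrt (form sigma t).
have s0 : (0 < s)%R by rewrite sqrtr_gt0.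
(* Rescaling to unit variance reduces the claim to the standard normal law. *)
pose t1 v := (s^-1 * t v)%R.
have t10 : nonzero t1.
  by case: t0 => v tv; exists v; rewrite mulf_neq0 // invr_eq0 gt_eqF.
have f1 : form sigma t1 = 1%R.
  by rewrite formZ exprVn sqr_sqrtr ?(ltW ft) // mulVf // gt_eqF.
transitivity (\int[P]_w ((form sigma t)%:E * (lincomb t1 w ^+ 2)%:E)).
  apply: eq_integral => w _; rewrite -EFinM lincombZ -[in RHS](sqr_sqrtr (ltW ft)) -/s.
  by congr EFin; field; rewrite gt_eqF.
rewrite ge0_integralZl //; last 3 first.
- by apply/measurable_EFinP; apply: measurable_funX.
- by move=> w _; rewrite lee_fin sqr_ge0.
- by rewrite lee_fin ltW.
congr (_ * _); rewrite (ge0_integral_lincomb t10 (f := fun x => x ^+ 2)%R).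
- by rewrite f1 sqrtr1.
- exact: exprn_measurable.
- by move=> x; exact: sqr_ge0.
Qed.

Definition kappa : R := fine (std_second_moment R).

Lemma kappaE : std_second_moment R = kappa%:E.
Proof.
rewrite /kappa fineK // ge0_fin_numE ?std_second_moment_lty //.
exact/ltW/std_second_moment_gt0.
Qed.

Lemma kappa_neq0 : kappa != 0%R.
Proof.
have := std_second_moment_gt0 R; rewrite kappaE lte_fin => k0.
by rewrite gt_eqF.
Qed.

Lemma integrable_lincomb_sqr t : nonzero t ->
  P.-integrable setT (fun w => (lincomb t w ^+ 2)%:E).
Proof.
move=> t0; apply/integrableP; split.
  by apply/measurable_EFinP; exact: measurable_funX.
under eq_integral do rewrite gee0_abs ?lee_fin ?sqr_ge0 //.
by rewrite second_moment_lincomb // kappaE -EFinM ltry.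
Qed.

Lemma integrable_lincomb t : nonzero t -> P.-integrable setT (EFin \o lincomb t).
Proof.
move=> t0; apply: (@le_integrable _ _ _ P _ measurableT _
  (fun w => 1%:E + (lincomb t w ^+ 2)%:E)).
- by apply/measurable_EFinP.
- move=> w _ /=; rewrite lee_fin [leRHS]ger0_norm ?addr_ge0 ?sqr_ge0 //.
  rewrite ler_norml; apply/andP; split; nra.
- apply: integrableD => //; last exact: integrable_lincomb_sqr.
  exact: finite_measure_integrable_cst.
Qed.

Lemma integrable_lincombM t t' : nonzero t -> nonzero t' ->
  P.-integrable setT (fun w => (lincomb t w * lincomb t' w)%:E).
Proof.
move=> t0 t0'; apply: (@le_integrable _ _ _ P _ measurableT _
  (fun w => (lincomb t w ^+ 2)%:E + (lincomb t' w ^+ 2)%:E)).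
- by apply/measurable_EFinP; exact: measurable_funM.
- move=> w _ /=; rewrite lee_fin [leRHS]ger0_norm ?addr_ge0 ?sqr_ge0 //.
  rewrite ler_norml; apply/andP; split; nra.
- by apply: integrableD => //; exact: integrable_lincomb_sqr.
Qed.

(** The combinations for [t] and [- t] have the same law, so the positive and negative parts have
    equal integrals. *)
Lemma mean_lincomb t : nonzero t -> \int[P]_w (lincomb t w)%:E = 0.
Proof.
move=> t0; pose t' v := (-1 * t v)%R.
have t0' : nonzero t' by case: t0 => v tv; exists v; rewrite /t' mulN1r oppr_eq0.
rewrite integralE.
have -> : \int[P]_w (fun w => (lincomb t w)%:E)^\- w =
          \int[P]_w (fun w => (lincomb t w)%:E)^\+ w.
  transitivity (\int[P]_w (Num.max (lincomb t' w) 0%R)%:E).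
    apply: eq_integral => w _.
    rewrite funenegE -EFinN -EFin_max; congr (Num.max _ _)%:E.
    by rewrite /t' lincombZ; ring.
  transitivity (\int[P]_w (Num.max (lincomb t w) 0%R)%:E); last first.
    by apply: eq_integral => w _; rewrite funeposE -EFin_max.
  apply: (same_law_lincomb (f := fun x => Num.max x 0%R)) => //.
  - by rewrite formZ; ring.
  - exact: measurable_maxr.
  - by move=> x; rewrite le_max lexx orbT.
by rewrite subee // integrable_pos_fin_num //; exact: integrable_lincomb.
Qed.

End GaussianField.

(** * Difference quotients of the hinge function *)

Section HingeDifference.
Variable R : realFieldType.
Implicit Types x y c k : R.

(** Twice the symmetric difference quotient at 0, with step [k^-1], of the function sending [a] to
    the positive part of [y + a * x - c]. *)
Definition hinge_diff k x y c : R :=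
  k * (Num.max (y + k^-1 * x - c) 0 - Num.max (y - k^-1 * x - c) 0).

Lemma max0_lip x y : `|Num.max x 0 - Num.max y 0| <= `|x - y|.
Proof.
rewrite ler_norml; have [hx|hx] := leP 0 x; have [hy|hy] := leP 0 y;
  have [hxy|hxy] := ger0P (x - y); rewrite ?subr0 ?sub0r; apply/andP; split; lra.
Qed.

Lemma hinge_diff_le k x y c : 0 < k -> `|hinge_diff k x y c| <= 2 * `|x|.
Proof.
move=> k0; rewrite normrM gtr0_norm //.
apply: le_trans (ler_wpM2l (ltW k0) (max0_lip _ _)) _.
have -> : y + k^-1 * x - c - (y - k^-1 * x - c) = 2 / k * x by field; rewrite gt_eqF.
rewrite normrM [`|2 / k|]ger0_norm ?divr_ge0 ?(ltW k0) //.
have -> : k * (2 / k * `|x|) = 2 * `|x| by field; rewrite gt_eqF.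
by [].
Qed.

(** For such [k] both arguments lie on the same side of the kink, so the quotient already equals its
    limit. *)
Lemma hinge_diffE k x y c : 0 < k -> `|x| <= k * `|y - c| -> y != c ->
  hinge_diff k x y c = 2 * (x * (c < y)%R%:R).
Proof.
move=> k0 xk yc; have {}xk : `|k^-1 * x| <= `|y - c|.
  by rewrite normrM gtr0_norm ?invr_gt0 // mulrC ler_pdivrMr // mulrC.
move: xk; rewrite ler_norml /hinge_diff; have [cy|cy] := ltP c y.
  rewrite ger0_norm ?subr_ge0 ?(ltW cy) // => /andP[h1 h2].
  rewrite !max_l; [|lra|lra].
  by rewrite mulr1; field; rewrite gt_eqF.
rewrite ler0_norm ?subr_le0 // => /andP[h1 h2].
rewrite !max_r; [|lra|lra].
by rewrite subrr !mulr0.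
Qed.

End HingeDifference.

(** * Uncorrelated combinations: vanishing integrals over events of one of them *)

Section Uncorrelated.
Context d (Omega : measurableType d) (R : realType) (P : probability Omega R).
Variables (V : finType) (X : V -> {RV P >-> R}) (mu : V -> R) (sigma : V -> V -> R).
Hypothesis sigma_pos : posdef sigma.
Hypothesis X_gauss : gaussian_vector X mu sigma.
Variables t t' : V -> R.
Hypotheses (t_neq0 : nonzero t) (t'_neq0 : nonzero t').
Hypothesis tt'0 : biform sigma t t' = 0.
Local Open Scope ereal_scope.

Let U := lincomb X mu t.
Let W := lincomb X mu t'.
Let mU : measurable_fun setT U := @measurable_lincomb _ _ _ _ _ X mu t.
Let mW : measurable_fun setT W := @measurable_lincomb _ _ _ _ _ X mu t'.

Let hinge (a c : R) (w : Omega) : R := Num.max (W w + a * U w - c)%R 0%R.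

Let measurable_hinge a c : measurable_fun setT (hinge a c).
Proof.
apply: measurable_maxr => //; apply: measurable_funB => //.
by apply: measurable_funD => //; exact: measurable_funM.
Qed.

Let nonzero_shift a : nonzero (fun v => t' v + a * t v)%R.
Proof.
apply: (@form_gt0_nonzero _ _ sigma); rewrite form_addZ; last exact: sigma_pos.1.
rewrite biformC ?tt'0; last exact: sigma_pos.1.
rewrite mulr0 addr0 ltr_pwDl ?(form_gt0 sigma_pos) //.
by rewrite mulr_ge0 ?sqr_ge0 // ltW // (form_gt0 sigma_pos).
Qed.

Let integrable_hinge a c : P.-integrable setT (fun w => (hinge a c w)%:E).
Proof.
have iL := integrable_lincomb sigma_pos X_gauss (nonzero_shift a).
apply: (@le_integrable _ _ _ P _ measurableT _
  (fun w => `|(lincomb X mu (fun v => t' v + a * t v)%R w)%:E| + `|c%:E|)).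
- exact/measurable_EFinP.
- move=> w _; rewrite /hinge lincombD -/U -/W -EFinD !abse_EFin lee_fin.
  have := max0_lip (W w + a * U w - c)%R 0%R; rewrite maxxx !subr0 => /le_trans; apply.
  rewrite [leRHS]ger0_norm ?addr_ge0 //; exact: ler_normB.
- apply: integrableD => //; first exact: integrable_abse.
  exact: finite_measure_integrable_cst.
Qed.

(** By [tt'0] the variance of [W + a U] has no term linear in [a], so the signs [a] and [- a] give
    the same law. *)
Let integral_hinge a c :
  \int[P]_w (hinge a c w)%:E = \int[P]_w (hinge (- a) c w)%:E.
Proof.
pose f x : R := Num.max (x - c)%R 0%R.
have mf : measurable_fun setT f by apply: measurable_maxr => //; exact: measurable_funB.
have f0 x : (0 <= f x)%R by rewrite le_max lexx orbT.
have fE b : \int[P]_w (hinge b c w)%:E =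
    \int[P]_w (f (lincomb X mu (fun v => t' v + b * t v)%R w))%:E.
  by apply: eq_integral => w _; rewrite lincombD.
rewrite !fE; apply: (same_law_lincomb sigma_pos X_gauss) => //.
have t't0 : biform sigma t' t = 0%R by rewrite biformC //; exact: sigma_pos.1.
by rewrite !form_addZ ?t't0 ?sqrrN ?mulr0 //; exact: sigma_pos.1.
Qed.

(* Differentiating [a |-> E (W + a U - c)^+], an even function of [a], at 0. *)
Let integral_halfline c : \int[P]_(w in W @^-1` `]c, +oo[) (U w)%:E = 0.
Proof.
pose F n w := (hinge_diff n.+1%:R (U w) (W w) c)%:E.
pose f w := (2 * (U w * (c < W w)%R%:R))%:E.
have iF n : \int[P]_w F n w = 0.
  transitivity (\int[P]_w (n.+1%:R%:E * ((hinge n.+1%:R^-1 c w)%:E -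
                                        (hinge (- n.+1%:R^-1) c w)%:E))).
    apply: eq_integral => w _; rewrite /F /hinge_diff /hinge -EFinB -EFinM.
    by rewrite mulNr.
  rewrite integralZl //; last exact: integrableB.
  have sub0 (x y : \bar R) : x = y -> y \is a fin_num -> x - y = 0.
    by move=> ->; exact: subee.
  rewrite integralB_EFin //; try exact: integrable_hinge.
  rewrite sub0; [exact: mule0|exact: integral_hinge|].
  by apply: integrable_fin_num => //; exact: integrable_hinge.
have mf : measurable_fun setT f.
  apply/measurable_EFinP; apply: measurable_funM => //; apply: measurable_funM => //.
  rewrite (_ : (fun w => _) = \1_(W @^-1` `]c, +oo[)).
    apply: measurable_indic; rewrite -[_ @^-1` _]setTI; exact: mW.
  apply/funext => w; rewrite indicE; congr (_%:R); congr nat_of_bool.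
  by apply/idP/idP; rewrite inE /= in_itv /= andbT.
have [_ _ cvgF] : [/\ P.-integrable setT f,
    [sequence \int[P]_w `|F n w - f w|]_n @ \oo --> 0 &
    [sequence \int[P]_w F n w]_n @ \oo --> \int[P]_w f w].
  apply: (@dominated_convergence _ _ _ _ _ measurableT F f (fun w => 2%:E * `|(U w)%:E|)).
  - move=> n; apply/measurable_EFinP; apply: measurable_funM => //.
    apply: measurable_funB; apply: measurable_maxr => //; apply: measurable_funB => //.
      by apply: measurable_funD => //; exact: measurable_funM.
    by apply: measurable_funB => //; exact: measurable_funM.
  - exact: mf.
  (* Pointwise convergence can fail only at the kink [W = c], a null event. Elsewhere the sequence
     is constant once [n] exceeds [|U| / |W - c|]. *)
  - exists (W @^-1` [set c]); split.
    + by rewrite -[_ @^-1` _]setTI; exact: mW.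
    + exact: (lincomb_set1 sigma_pos X_gauss).
    + move=> w /= h; apply: contrapT => wc; apply: h => _.
      apply: cvg_near_cst; near=> n; rewrite /F hinge_diffE //.
      * have : (`|U w| / `|W w - c| <= n.+1%:R)%R.
          apply: (@le_trans _ _ n%:R); last by rewrite ler_nat.
          by near: n; exact: nbhs_infty_ger.
        by rewrite ler_pdivrMr // normr_gt0 subr_eq0; apply/eqP.
      * exact/eqP.
  - apply: integrableZl => //; apply: integrable_abse.
    exact: (integrable_lincomb sigma_pos X_gauss).
  - by apply: aeW => w n _; rewrite /F abse_EFin -EFinM lee_fin hinge_diff_le.
have {}cvgF : \int[P]_w f w = 0.
  apply: (cvg_unique _ cvgF) => //.
  rewrite (_ : [sequence _]_n = cst 0); first exact: cvg_cst.
  by apply/funext => n; rewrite /= iF.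
have : 2%:E * \int[P]_(w in W @^-1` `]c, +oo[) (U w)%:E = 0.
  rewrite -cvgF integral_mkcond -integralZl //; last first.
    apply/(integrable_mkcond _ _).1 => //; first by rewrite -[_ @^-1` _]setTI; exact: mW.
    apply: integrableS (integrable_lincomb sigma_pos X_gauss t_neq0) => //.
    by rewrite -[_ @^-1` _]setTI; exact: mW.
  apply: eq_integral => w _; rewrite patchE /f EFinM; congr (_ * _).
  have -> : (w \in W @^-1` `]c, +oo[) = (c < W w)%R.
    by apply/idP/idP; rewrite inE /= in_itv /= andbT.
  by case: ifP => _; rewrite ?mulr1 ?mulr0.
move=> /eqP; rewrite mule_eq0 => /orP[|/eqP//].
by rewrite eqe pnatr_eq0.
Unshelve. all: by end_near. Qed.

(** Half-lines are stable under intersection and generate the Borel sets, so Dynkin's theorem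
    applies; the complement step uses that [U] has mean 0. *)
Lemma integral_uncorrelated_preimage (B : set R) : measurable B ->
  \int[P]_(w in W @^-1` B) (U w)%:E = 0.
Proof.
have mWB (C : set R) : measurable C -> measurable (W @^-1` C).
  by move=> mC; rewrite -[_ @^-1` _]setTI; exact: mW.
have iU := integrable_lincomb sigma_pos X_gauss t_neq0.
have iUD D : measurable D -> P.-integrable D (EFin \o U).
  by move=> mD; apply: integrableS iU.
have U0 : \int[P]_w (U w)%:E = 0 by exact: (mean_lincomb sigma_pos X_gauss).
have mE : @measurable _ R = <<s @RGenOInfty.G R >>.
  exact: RGenOInfty.measurableE.
rewrite mE; move: B.
apply: (@dynkin_induction _ R (@RGenOInfty.G R)
  (fun B => \int[P]_(w in W @^-1` B) (U w)%:E = 0)) => //.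
- move=> _ _ [x ->] [y ->]; exists (Num.max x y).
  by apply/seteqP; split => z /=; rewrite !in_itv /= !andbT gt_max => /andP.
- by move=> _ [x ->]; exact: integral_halfline.
- move=> C mC C0; have := U0; rewrite -(setUv (W @^-1` C)) integral_setU.
  + by rewrite C0 add0e preimage_setC.
  + exact: mWB.
  + exact/measurableC/mWB.
  + by rewrite setUv; exact/measurable_EFinP.
  + by apply/disj_setPS; rewrite setICr.
move=> F mF tF F0; rewrite preimage_bigcup integral_bigcup //.
- by rewrite eseries0 // => n _ _; exact: F0.
- by move=> i j _ _ [w [Fi Fj]]; apply: tF => //; exists (W w).
- by move=> n; exact: mWB.
- by apply: iUD; apply: bigcupT_measurable => n; exact: mWB.
Qed.

End Uncorrelated.

(** * Conditional independence *)

Section ConditionalIndependence.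
Context d (Omega : measurableType d) (R : realType) (P : probability Omega R).
Local Open Scope ereal_scope.

(** On the event [Y < 0] the integral is also at most 0, so it vanishes, and so does [Y] almost
    everywhere there, which is absurd off a null set. *)
Lemma ae_ge0 (Y : Omega -> R) : P.-integrable setT (EFin \o Y) ->
    0 <= \int[P]_(w in Y @^-1` `]-oo, 0%R[) (Y w)%:E ->
  {ae P, forall w, (0 <= Y w)%R}.
Proof.
move=> iY; have mY : measurable_fun setT Y by exact/measurable_EFinP/(measurable_int P).
set C := Y @^-1` _ => C0.
have mC : measurable C by rewrite -[C]setTI; exact: mY.
have YC w : C w -> (Y w < 0)%R by rewrite /C /= in_itv.
have : \int[P]_(w in C) `|(Y w)%:E| = 0.
  apply/eqP; rewrite eq_le integral_ge0 ?andbT //.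
  rewrite -[leRHS]oppe0 leeNr (le_trans C0) // -integral_ge0N.
    rewrite le_eqVlt; apply/orP; left; apply/eqP; apply: eq_integral => w /set_mem /YC Yw.
    by rewrite lte0_abs ?lte_fin // oppeK.
  by move=> w _; exact: abse_ge0.
case/(ae_eq_integral_abs _ mC) => [|N [mN N0 subN]].
  by apply/measurable_EFinP; exact: measurable_funTS.
exists N; split => // w /= /negP; rewrite -ltNge => Yw; apply: subN => /= h.
have /h : C w by rewrite /C /= in_itv.
by case=> Yw0; rewrite Yw0 ltxx in Yw.
Qed.

Section Version.
Variables (G : set (set Omega)) (B : set Omega) (g : Omega -> R).
Hypotheses (G_meas : G `<=` measurable) (mB : measurable B).
Hypothesis g_version : cond_prob_version P G B g.

Let ig : P.-integrable setT (EFin \o g). Proof. by case: g_version. Qed.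
Let mg : measurable_fun setT g. Proof. exact/measurable_EFinP/(measurable_int P). Qed.

Lemma version_ge0 : {ae P, forall w, (0 <= g w)%R}.
Proof.
by case: g_version => gG _ gE; apply: ae_ge0 => //; rewrite gE //; exact: gG.
Qed.

(** The event [g > 1] belongs to [G]; over it [1 - g] integrates to the probability of the event
    minus that of its intersection with [B]. *)
Lemma version_le1 : {ae P, forall w, (g w <= 1)%R}.
Proof.
have [gG _ gE] := g_version.
have i1 : P.-integrable setT (fun w => (1 - g w)%:E).
  under eq_fun do rewrite EFinB.
  by apply: integrableB => //; exact: finite_measure_integrable_cst.
suff : {ae P, forall w, (0 <= 1 - g w)%R}.
  by apply: filterS => w; rewrite subr_ge0.
apply: ae_ge0 => //.
have -> : (fun w => 1 - g w)%R @^-1` `]-oo, 0%R[ = g @^-1` `]1%R, +oo[.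
  by apply/seteqP; split => w /=; rewrite !in_itv /= andbT subr_lt0.
have GC : G (g @^-1` `]1%R, +oo[) by exact: gG.
have mC := G_meas GC.
under eq_integral do rewrite EFinB.
rewrite integralB_EFin //; last 2 first.
- exact: finite_measure_integrable_cst.
- by apply: integrableS ig.
rewrite gE // integral_cst // mul1e sube_ge0; last first.
  by rewrite fin_num_measure //; exact: measurableI.
by apply: le_measure; rewrite ?inE //; exact: measurableI.
Qed.

(** A version with values in the unit interval everywhere, so that its product with any integrable
    variable is integrable. *)
Definition clip (w : Omega) : R := Num.max 0%R (Num.min (g w) 1%R).

Lemma measurable_clip : measurable_fun setT clip.
Proof. by apply: measurable_maxr => //; exact: measurable_minr. Qed.

Lemma clip_ge0 w : (0 <= clip w)%R.
Proof. by rewrite /clip le_max lexx. Qed.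

Lemma clip_le1 w : (clip w <= 1)%R.
Proof. by rewrite /clip ge_max ler01 /= ge_min lexx orbT. Qed.

Lemma clip_preimage (C : set R) : measurable C -> G (clip @^-1` C).
Proof.
move=> mC; have [gG _ _] := g_version.
have mphi : measurable_fun setT (fun x : R => Num.max 0%R (Num.min x 1%R)).
  by apply: measurable_maxr => //; exact: measurable_minr.
rewrite (_ : _ @^-1` _ = g @^-1` ((fun x : R => Num.max 0%R (Num.min x 1%R)) @^-1` C)) //.
by apply: gG; rewrite -[_ @^-1` _]setTI; exact: mphi.
Qed.

Lemma integrable_clip D : measurable D -> P.-integrable D (EFin \o clip).
Proof.
move=> mD; apply: (@integrableS _ _ _ P setT) => //.
apply: (@le_integrable _ _ _ P _ measurableT _ (cst 1)).
- exact/measurable_EFinP/measurable_clip.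
- by move=> w _ /=; rewrite lee_fin normr1 ger0_norm ?clip_ge0 // clip_le1.
- exact: finite_measure_integrable_cst.
Qed.

Lemma integral_clip C : G C -> \int[P]_(w in C) (clip w)%:E = P (B `&` C).
Proof.
move=> GC; have [_ _ <- //] := g_version; have mC := G_meas GC.
apply: ae_eq_integral => //.
- exact/measurable_EFinP/measurable_funTS/measurable_clip.
- exact/measurable_EFinP/measurable_funTS.
apply: filterS2 version_ge0 version_le1 => w g0 g1 _.
by rewrite /clip min_l // max_r.
Qed.

End Version.
End ConditionalIndependence.

(** * From conditional independence to a covariance identity *)

Section GaussianConditionalIndependence.
Context d (Omega : measurableType d) (R : realType) (P : probability Omega R).
Variables (V : finType) (X : V -> {RV P >-> R}) (mu : V -> R) (sigma : V -> V -> R).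
Local Open Scope ereal_scope.

Lemma sigma_of1 v :
  sigma_of X [set v]%SET = preimage_set_system setT (X v) measurable.
Proof.
rewrite /sigma_of (_ : \bigcup_(_ in _) _ =
  preimage_set_system setT (X v) measurable); last first.
  apply/seteqP; split=> A; first by case=> x /=; rewrite inE => /eqP ->.
  by move=> XA; exists v => //=; rewrite inE.
apply: sigma_algebra_id; apply: sigma_algebra_preimage.
exact: sigma_algebra_measurable.
Qed.

Lemma sigma_of1_measurable v : sigma_of X [set v]%SET `<=` measurable.
Proof.
rewrite sigma_of1 => _ [B mB <-]; exact: measurable_funPT.
Qed.

Lemma sigma_of1T v : sigma_of X [set v]%SET setT.
Proof. by rewrite sigma_of1; exists setT => //; rewrite preimage_setT setIT. Qed.

Lemma sigma_of1_centered v (A : set Omega) : sigma_of X [set v]%SET A <->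
  exists2 B : set R, measurable B &
    A = lincomb X mu (fun u => (u == v)%:R) @^-1` B.
Proof.
have mshift (c : R) (B : set R) : measurable B -> measurable ((fun x => x + c)%R @^-1` B).
  move=> mB; have mc : measurable_fun setT (fun x : R => x + c)%R.
    exact: measurable_funD.
  by rewrite -[_ @^-1` _]setTI; exact: mc.
rewrite sigma_of1; split=> [[B mB <-]|[B mB ->]].
  exists ((fun x => x + mu v)%R @^-1` B); first exact: mshift.
  by rewrite setTI; apply/seteqP; split=> w /=; rewrite lincomb_delta subrK.
exists ((fun x => x + - mu v)%R @^-1` B); first exact: mshift.
by rewrite setTI; apply/seteqP; split=> w /=; rewrite lincomb_delta.
Qed.

Hypothesis sigma_pos : posdef sigma.
Hypothesis X_gauss : gaussian_vector X mu sigma.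

Let delta v : V -> R := fun u => (u == v)%:R.

Let delta_nonzero v : nonzero (delta v).
Proof. by exists v; rewrite /delta eqxx oner_neq0. Qed.

Lemma biform_delta t v : biform sigma t (delta v) = (\sum_u t u * sigma u v)%R.
Proof. by rewrite /biform; apply: eq_bigr => u _; rewrite /delta sum_delta. Qed.

Section Triple.
Variables u v w : V.
Hypotheses (uv : u != v) (uw : u != w).
Hypothesis ci : cond_indep X [set u]%SET [set v]%SET [set w]%SET.

Let Gw := sigma_of X [set w]%SET.

(* [ci] provides for each [A] another version [h] of [P(B | X_w)]; the version [f]
   of [P(A | X_w)] that comes with it allows to replace [h] by [clip g]. *)
Lemma integral_clip_cond_indep A B g :
    cond_prob_version P Gw B g -> sigma_of X [set u]%SET A -> sigma_of X [set v]%SET B ->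
  \int[P]_(x in A) (clip g x)%:E = P (A `&` B).
Proof.
move=> vg uA vB; have mA := sigma_of1_measurable uA; have mB := sigma_of1_measurable vB.
have Gm : Gw `<=` measurable by exact: sigma_of1_measurable.
have [f [h [vf vh vfh]]] := ci uA vB.
have [fG if_ fE] := vf; have [hG ih hE] := vh; have [_ ifh fhE] := vfh.
have mf : measurable_fun setT f by exact/measurable_EFinP/(measurable_int P).
have mh : measurable_fun setT h by exact/measurable_EFinP/(measurable_int P).
have mcl : measurable_fun setT (clip g) by exact: (measurable_clip vg).
have icl : P.-integrable setT (EFin \o clip g) by exact: (integrable_clip vg).
have iclM (k : Omega -> R) : P.-integrable setT (EFin \o k) ->
    P.-integrable setT (fun x => (k x * clip g x)%:E).
  move=> ik; apply: (le_integrable measurableT _ _ ik).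
    apply/measurable_EFinP; apply: measurable_funM => //.
    exact/measurable_EFinP/(measurable_int P).
  move=> x _; rewrite lee_fin normrM ler_piMr // ger0_norm ?clip_ge0 //.
  exact: clip_le1.
have i1A : P.-integrable setT (EFin \o \1_A) by exact: integrable_indic.
transitivity (\int[P]_x (\1_A x * clip g x)%:E).
  rewrite integral_mkcond; apply: eq_integral => x _; rewrite patchE indicE.
  by case: ifP => _; rewrite ?mul1r ?mul0r.
(* [clip g] is measurable for [Gw], so the indicator of [A] may be replaced by its conditional
   probability [f]. *)
transitivity (\int[P]_x (f x * clip g x)%:E).
  apply: eq_integral_mul_preimage => //; [exact: iclM|exact: iclM|].
  move=> C mC; have GC := clip_preimage vg mC.
  by rewrite fE // integral_indic //; exact: Gm.
transitivity (\int[P]_x (clip g x * f x)%:E).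
  by apply: eq_integral => x _; rewrite mulrC.
(* Conversely [f] is measurable for [Gw], and [clip g] and [h] have the same integrals over events
   of [Gw]. *)
transitivity (\int[P]_x (h x * f x)%:E).
  apply: eq_integral_mul_preimage => //.
  - by under eq_fun do rewrite mulrC; exact: iclM.
  - by under eq_fun do rewrite mulrC.
  by move=> C mC; rewrite (integral_clip Gm mB vg) ?hE //; exact: fG.
have := fhE setT (@sigma_of1T w); rewrite setIT => <-.
by apply: eq_integral => x _; rewrite mulrC.
Qed.

Let alpha := (sigma u w / sigma w w)%R.
(** Coefficients of the residual of [X u] after regression on [X w]; [alpha] is the regression
    coefficient. *)
Let t x := (delta u x + - alpha * delta w x)%R.
Let U := lincomb X mu t.

Let t_at_u : t u = 1%R.
Proof. by rewrite /t /delta eqxx (negbTE uw) mulr0 addr0. Qed.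

Let t_nonzero : nonzero t.
Proof. by exists u; rewrite t_at_u oner_neq0. Qed.

Lemma biform_tE x : biform sigma t (delta x) = (sigma u x - alpha * sigma w x)%R.
Proof.
rewrite biform_delta /t; under eq_bigr do rewrite mulrDl -mulrA.
by rewrite big_split -mulr_sumr /delta !sum_deltal mulNr.
Qed.

Let biform_tw : biform sigma t (delta w) = 0%R.
Proof. by rewrite biform_tE /alpha divfK ?subrr // posdef_diag_neq0. Qed.

(** The indicator of [B] may be replaced by [clip g] both against [X u], by conditional
    independence, and against [X w], by the definition of a version. What remains pairs the residual
    with a variable measurable for [X w]. *)
Lemma integral_residual B : sigma_of X [set v]%SET B -> \int[P]_(x in B) (U x)%:E = 0.
Proof.
move=> vB; have mB := sigma_of1_measurable vB.
have Gm : Gw `<=` measurable by exact: sigma_of1_measurable.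
have [_ [g [_ vg _]]] := ci (@sigma_of1T u) vB.
have mcl : measurable_fun setT (clip g) by exact: (measurable_clip vg).
have icl : P.-integrable setT (EFin \o clip g) by exact: (integrable_clip vg).
have i1B : P.-integrable setT (EFin \o \1_B) by exact: integrable_indic.
have bounded_mul (b k : Omega -> R) : measurable_fun setT b ->
    (forall x, 0 <= b x <= 1)%R -> P.-integrable setT (EFin \o k) ->
    P.-integrable setT (fun x => (b x * k x)%:E).
  move=> mb b01 ik; apply: (le_integrable measurableT _ _ ik).
    apply/measurable_EFinP; apply: measurable_funM => //.
    exact/measurable_EFinP/(measurable_int P).
  move=> x _; have /andP[b0 b1] := b01 x.
  by rewrite lee_fin normrM ler_piMl // ger0_norm.
have clip01 x : (0 <= clip g x <= 1)%R by rewrite clip_ge0 clip_le1.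
have ind01 x : (0 <= (\1_B x : R) <= 1)%R by rewrite indicE ler0n lern1 leq_b1.
have m1B : measurable_fun setT (\1_B : Omega -> R) by exact: measurable_indic.
have iL x := integrable_lincomb sigma_pos X_gauss (delta_nonzero x).
have swap x : (forall A, sigma_of X [set x]%SET A ->
      \int[P]_(y in A) (clip g y)%:E = P (A `&` B)) ->
    \int[P]_y (\1_B y * lincomb X mu (delta x) y)%:E =
    \int[P]_y (clip g y * lincomb X mu (delta x) y)%:E.
  move=> xE; apply: eq_integral_mul_preimage => //.
  - exact: measurable_lincomb.
  - exact: bounded_mul.
  - exact: bounded_mul.
  move=> C mC; have xC : sigma_of X [set x]%SET (lincomb X mu (delta x) @^-1` C).
    by apply/sigma_of1_centered; exists C.
  by rewrite xE // integral_indic 1?setIC //; exact: sigma_of1_measurable xC.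
have Eu := swap u (fun A uA => integral_clip_cond_indep vg uA vB).
have Ew : \int[P]_y (\1_B y * lincomb X mu (delta w) y)%:E =
          \int[P]_y (clip g y * lincomb X mu (delta w) y)%:E.
  by apply: swap => A wA; rewrite (integral_clip Gm mB vg wA) setIC.
have UE (b : Omega -> R) : measurable_fun setT b -> (forall x, 0 <= b x <= 1)%R ->
    \int[P]_y (b y * U y)%:E = \int[P]_y (b y * lincomb X mu (delta u) y)%:E +
      (- alpha)%:E * \int[P]_y (b y * lincomb X mu (delta w) y)%:E.
  move=> mb b01; rewrite -integralZl //; last exact: bounded_mul.
  rewrite -integralD //; [|exact: bounded_mul|]; last first.
    by apply: integrableZl => //; exact: bounded_mul.
  apply: eq_integral => y _; rewrite -EFinM -EFinD /U lincombD; congr EFin; ring.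
transitivity (\int[P]_y (\1_B y * U y)%:E).
  rewrite integral_mkcond; apply: eq_integral => x _; rewrite patchE indicE.
  by case: ifP => _; rewrite ?mul1r ?mul0r.
rewrite UE // Eu Ew -UE //.
transitivity (\int[P]_y (U y * clip g y)%:E).
  by apply: eq_integral => y _; rewrite mulrC.
apply: integral_mul_preimage_eq0 => //.
- exact: (integrable_lincomb sigma_pos X_gauss).
- under eq_fun do rewrite mulrC; apply: bounded_mul => //.
  exact: (integrable_lincomb sigma_pos X_gauss).
move=> C mC; have /sigma_of1_centered[D mD ->] := clip_preimage vg mC.
exact: (integral_uncorrelated_preimage sigma_pos X_gauss t_nonzero
  (delta_nonzero w) biform_tw).
Qed.

Lemma integral_residualM : \int[P]_x (U x * lincomb X mu (delta v) x)%:E = 0.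
Proof.
apply: integral_mul_preimage_eq0.
- exact: measurable_lincomb.
- exact: (integrable_lincomb sigma_pos X_gauss).
- exact: (integrable_lincombM sigma_pos X_gauss).
by move=> C mC; apply: integral_residual; apply/sigma_of1_centered; exists C.
Qed.

(** Polarization: as [U] times the centered [X v] integrates to 0, their sum and difference have
    equal second moments. These are [kappa] times the forms, so the cross term of the forms
    vanishes. *)
Lemma cond_indep_cov : (sigma u v * sigma w w = sigma u w * sigma w v)%R.
Proof.
have tv_nonzero a : nonzero (fun x => t x + a * delta v x)%R.
  by exists u; rewrite t_at_u /delta (negbTE uv) mulr0 addr0 oner_neq0.
have UV0 := integral_residualM.
have iUV := integrable_lincombM sigma_pos X_gauss t_nonzero (delta_nonzero v).
have i2 := integrable_lincomb_sqr sigma_pos X_gauss (tv_nonzero (-1)%R).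
have : \int[P]_x (lincomb X mu (fun x => t x + 1 * delta v x)%R x ^+ 2)%:E =
       \int[P]_x (lincomb X mu (fun x => t x + -1 * delta v x)%R x ^+ 2)%:E.
  transitivity (\int[P]_x ((lincomb X mu (fun x => t x + -1 * delta v x)%R x ^+ 2)%:E +
      4%:E * (U x * lincomb X mu (delta v) x)%:E)).
    apply: eq_integral => x _; rewrite -EFinM -EFinD /U !lincombD; congr EFin; ring.
  by rewrite integralD // ?integralZl ?UV0 ?mule0 ?adde0 //; exact: integrableZl.
rewrite !(second_moment_lincomb sigma_pos X_gauss) // (kappaE R) -!EFinM.
move=> [] /(mulIf (kappa_neq0 R)).
rewrite !form_addZ; try exact: sigma_pos.1.
rewrite biform_tE => h.
have : (sigma u v - alpha * sigma w v = 0)%R by lra.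
rewrite /alpha => /subr0_eq ->.
by rewrite mulrAC divfK // posdef_diag_neq0.
Qed.

End Triple.
End GaussianConditionalIndependence.

(** * Gaussian trees and the inequality *)

Lemma gaussian_tree_markov (R : realType) (d : measure_display)
    (Omega : measurableType d) (P : probability Omega R)
    (V : finType) (e : rel V) (X : V -> {RV P >-> R})
    (mu : V -> R) (sigma : V -> V -> R) :
  gaussian_tree X e mu sigma -> tree_markov e sigma.
Proof.
move=> [tree_e sigma_pos X_gauss X_markov] w u v wuv.
have s0 := posdef_diag_neq0 sigma_pos.
have [uw|uw] := eqVneq u w; first by rewrite uw mulrAC mulfV ?mul1r.
have [vw|vw] := eqVneq v w; first by rewrite vw mulfK.
(* A vertex other than [w] stays connected to itself after deletion of [w]. *)
have uv : u != v.
  by apply: contraTneq wuv => ->; rewrite /cuts (negbTE vw) /= connect0.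
have disj (x y : V) : x != y -> [disjoint [set x]%SET & [set y]%SET]%B.
  by move=> xy; rewrite disjoints1 inE.
apply: (canRL (mulfK (s0 w))); apply: (cond_indep_cov sigma_pos X_gauss uv uw).
apply: X_markov; rewrite ?disj //.
by apply: cuts_graph_separated => //; rewrite eq_sym.
Qed.

Theorem corollary3 (R : realType) (d : measure_display)
    (Omega : measurableType d) (P : probability Omega R)
    (V : finType) (e : rel V) (X : V -> {RV P >-> R})
    (mu : V -> R) (sigma : V -> V -> R)
    (a c c' : V) (Z Z' : {set V}) :
  gaussian_tree X e mu sigma ->
  a != c ->
  Z \subset ~: [set a; c] ->
  Z' \subset ~: [set a; c'] ->
  on_path e a c' c ->
  graph_separated e [set a; c'] Z Z' ->
  sq_pcorr sigma a c' Z' <= sq_pcorr sigma a c Z.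
Proof.
move=> gt _ _ _ cac' sep; have [tree_e sigma_pos _ _] := gt.
have [e_sym e_irr e_conn e_acyclic] := tree_e.
have ms := gaussian_tree_markov gt; have ps := posdef_psd sigma_pos.
have sqE x y (S : {set V}) l :
    l =i S -> sq_pcorr sigma x y S = sqcorr (condl sigma l) x y.
  by move=> lS; rewrite /sq_pcorr !(pcov_condl sigma_pos _ _ lS).
have cutZ x z : x \in [set a; c']%SET -> z \in enum Z ->
    exists2 w, w \in enum Z' & cuts e w x z.
  move=> xac; rewrite mem_enum => zZ; have [p xzp] := e_conn x z.
  have [w wp wZ'] := sep.2 _ _ _ xac zZ xzp; exists w; first by rewrite mem_enum.
  by apply: tree_on_path_cuts => //; exists p.
rewrite (sqE a c' Z' (enum Z')) => [|x]; last by rewrite mem_enum.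
rewrite (sqE a c Z (enum Z)) => [|x]; last by rewrite mem_enum.
(* On the left, conditioning on [Z] after [Z'] changes nothing, by the assumed separation. *)
rewrite -(sqcorr_condl_separated tree_e (l' := enum Z) ps ms); first last.
- by move=> z; apply: cutZ; rewrite !inE eqxx orbT.
- by move=> z; apply: cutZ; rewrite !inE eqxx.
rewrite -(sqE a c' (Z' :|: Z)%SET) => [|x]; last by rewrite mem_cat !mem_enum inE.
rewrite (sqE a c' (Z' :|: Z)%SET (enum Z ++ enum Z')) => [|x]; last first.
  by rewrite mem_cat !mem_enum inE orbC.
apply: le_trans (sqcorr_condl_le tree_e a c' (enum Z) (enum Z') ps ms) _.
(* With [Z] alone conditioned on, [c'] is replaced by [c], which separates it from [a]. *)
apply: (@sqcorr_cuts _ _ e); [exact: condl_psd|exact: condl_tree_markov|].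
exact: tree_on_path_cuts.
Qed.
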